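(* When restricted to instances with $\tilde{c}>k$, FDMC is fixed-parameter tractable with respect to $k$.
   Context: An instance of \textsc{Fair Discrete Means Cluster Editing} (FDMC) consists of an $m\times n$ matrix $M$ (over some finite domain), a vector $\gamma\in[c]^m$ (the color of row $i$ is $\gamma[i]$), and positive integers $k$ and $r$. A cluster of a matrix is a maximal set of pairwise identical rows. For a color $i\in[c]$ let $|\gamma|_i$ be the number of entries of $\gamma$ equal to $i$. A matrix $M'$ with $m$ rows is fair (w.r.t. $\gamma$) if every cluster $S$ of $M'$ contains exactly $\frac{|\gamma|_i}{m}|S|$ rows of color $i$, for every $i\in[c]$. The task is to decide whether there exists (and find) a fair $m\times n$ matrix $M'$ that differs from $M$ in at most $k$ entries and has at most $r$ distinct rows. The fairlet size is $\tilde{c}=m/\gcd(|\gamma|_1,\dots,|\gamma|_c)$. *)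

(* Defs.v *)
From HB Require Import structures.
From mathcomp Require Import all_boot all_order all_algebra.

Set Implicit Arguments.
Unset Strict Implicit.
Unset Printing Implicit Defensive.

(** Random access machines: a program is a finite list of instructions acting on registers and on a
  memory, both indexed by [nat] and holding natural numbers. Every instruction
  costs one unit of time. As addition and truncated subtraction are the only
  arithmetic operations, a value grows by at most one bit per step, and this
  cost measure is polynomially related to Turing machine time. *)

Inductive instr : Type :=
| IConst (r v : nat)
| IAdd (r a b : nat)
| ISub (r a b : nat)
| ILoad (r a : nat)
| IStore (a b : nat)
| IJumpz (r l : nat).

Definition program := seq instr.

Record state := State {
  pc : nat;
  regs : nat -> nat;
  memory : nat -> nat
}.

Definition upd (f : nat -> nat) (a v : nat) : nat -> nat :=
  fun x => if x == a then v else f x.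

Definition exec (i : instr) (s : state) : state :=
  let: State p R m := s in
  match i with
  | IConst r v => State p.+1 (upd R r v) m
  | IAdd r a b => State p.+1 (upd R r (R a + R b)) m
  | ISub r a b => State p.+1 (upd R r (R a - R b)) m
  | ILoad r a => State p.+1 (upd R r (m (R a))) m
  | IStore a b => State p.+1 R (upd m (R a) (R b))
  | IJumpz r l => State (if R r == 0 then l else p.+1) R m
  end.

(** The machine halts when the program counter leaves the program. *)
Definition halted (P : program) (s : state) : bool := size P <= pc s.

Definition step (P : program) (s : state) : state :=
  if onth P (pc s) is Some i then exec i s else s.

(** Initially register 0 contains the length of the input and memory cells
  0, 1, ... contain the input; everything else is 0. The output is read in the
  same way from a halted state. *)
Definition init_state (w : seq nat) : state :=
  State 0 (upd (fun=> 0) 0 (size w)) (nth 0 w).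

Definition output (s : state) : seq nat := mkseq (memory s) (regs s 0).

Definition outputs_in (P : program) (w : seq nat) (t : nat) (o : seq nat) :
    Prop :=
  let s := iter t (step P) (init_state w) in halted P s /\ output s = o.

Definition computable (f : nat -> nat) : Prop :=
  exists P : program, forall x, exists t, outputs_in P [:: x] t [:: f x].

(** [answer x o] means that [o] is an admissible output on the instance [x]:
  this covers decision problems as well as problems asking for a solution. *)
Record param_problem := ParamProblem {
  instance : Type;
  encode : instance -> seq nat;
  parameter : instance -> nat;
  answer : instance -> seq nat -> Prop
}.

Definition restrict (Pb : param_problem) (C : instance Pb -> Prop) :
    param_problem :=
  @ParamProblem {x : instance Pb | C x}
    (fun x => encode (sval x))
    (fun x => parameter (sval x))
    (fun x => answer (sval x)).

(** Total binary length of the words of [w]; the word 0 takes one bit. *)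
Definition bitsize (w : seq nat) : nat :=
  \sum_(x <- w) (trunc_log 2 x).+1.

Definition fixed_parameter_tractable (Pb : param_problem) : Prop :=
  exists (P : program) (f : nat -> nat) (d : nat),
    computable f /\
    forall x : instance Pb, exists t o,
      [/\ t <= f (parameter x) * bitsize (encode x) ^ d,
          outputs_in P (encode x) t o
        & answer x o].

Section Matrices.
Variables (s m n : nat).
Implicit Types (M : 'M['I_s]_(m, n)) (S : {set 'I_m}).

Definition cluster M S : bool :=
  maxset (fun S' : {set 'I_m} =>
            [forall i in S', forall j in S', row i M == row j M]) S.

Definition color_count c (gamma : m.-tuple 'I_c) (i : 'I_c) : nat :=
  count_mem i gamma.

Definition fair c (gamma : m.-tuple 'I_c) M : Prop :=
  forall S, cluster M S -> forall i : 'I_c,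
    (#|[set x in S | tnth gamma x == i]|%:R
       = (color_count gamma i)%:R / m%:R * #|S|%:R :> rat)%R.

Definition distance M M' : nat :=
  #|[set p : 'I_m * 'I_n | M p.1 p.2 != M' p.1 p.2]|.

Definition distinct_rows M : nat := #|[set row i M | i : 'I_m]|.

Definition entries M : seq nat :=
  [seq (M i j : nat) | i <- enum 'I_m, j <- enum 'I_n].

End Matrices.

(** The finite domain of the matrix is ['I_(dom_size)] and is part of the
  instance; the colors are numbered from 0. *)
Record fdmc_instance := FDMCInstance {
  nrows : nat;
  ncols : nat;
  ncolors : nat;
  dom_size : nat;
  mat : 'M['I_dom_size]_(nrows, ncols);
  color : nrows.-tuple 'I_ncolors;
  budget : nat;
  max_rows : nat;
  budget_gt0 : 0 < budget;
  max_rows_gt0 : 0 < max_rows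
}.

Definition fdmc_solution (I : fdmc_instance)
    (M' : 'M['I_(dom_size I)]_(nrows I, ncols I)) : Prop :=
  [/\ fair (color I) M',
      distance (mat I) M' <= budget I
    & distinct_rows M' <= max_rows I].

Definition fairlet_size (I : fdmc_instance) : nat :=
  nrows I %/ \big[gcdn/0]_(i < ncolors I) color_count (color I) i.

Definition fdmc_encode (I : fdmc_instance) : seq nat :=
  [:: nrows I; ncols I; ncolors I; dom_size I; budget I; max_rows I]
    ++ entries (mat I) ++ [seq nat_of_ord i | i <- color I].

(** The output is [0] on no-instances, and 1 followed by the entries of a
  solution, row by row, on yes-instances. *)
Definition fdmc_answer (I : fdmc_instance) (o : seq nat) : Prop :=
  (o = [:: 0] /\ ~ exists M', @fdmc_solution I M')
  \/ exists M', @fdmc_solution I M' /\ o = 1 :: entries M'.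

(** Fair Discrete Means Cluster Editing, parameterized by the number [k] of
  allowed modifications (and not by [r]). *)
Definition FDMC : param_problem :=
  ParamProblem fdmc_encode budget fdmc_answer.

(* Main.v *)
Require Import Defs.
From mathcomp Require Import all_boot all_order all_algebra perm zify.

(** Since every cluster of a fair matrix has a multiple of [c~ > k] rows, each
  cluster of a solution keeps an unmodified row, so a solution is a map sending
  each row to a row of the input that replaces it. Exchanging the images of two
  rows of the same color, we may assume that no color both enters and leaves a
  cluster, and that the rows of a given color leaving a cluster are the first
  ones. Then the clusters that are already fair are untouched, because their
  size would change by a nonzero multiple of [c~]; as each modified row touches
  two clusters, at most [2k] clusters are unfair. The solution is therefore
  determined by at most [3k] numbers [<= 2k]: the new size of each unfair
  cluster, which fixes the rows that leave it, and the destination of each of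
  the at most [k] leaving rows.
  The algorithm tries all these guesses. Given the guess, every entry of the
  output is a formula with bounded loops over the read-only input, and such
  formulas are compiled to random access machines. *)

Set Implicit Arguments.
Unset Strict Implicit.
Unset Printing Implicit Defensive.

(** * Compiling expressions to random access machines *)

(** The new size of a cluster fixes the rows that leave it for two reasons. Fairness turns the size
    into the number of rows of each color. Where that number drops, the drop is exactly the number
    of leaving rows, since no row of that color enters. The normalization by exchanges serves
    completeness only. Whatever map a guess decodes to, its fairness, its cost and its number of
    distinct rows are checked in full, so an accepted guess always yields a solution; [r] enters
    only in this check. The guess is packed into a single number, with digits in base [2 * k + 1],
    so that the search is one loop. Nothing is tabulated: each count is recomputed wherever it is
    used, so no data structure in memory has to be reasoned about. All costs are bounded by powers
    of one quantity, the number of guesses times the input length. Such a power splits into a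
    function of [k] and a polynomial in the input length, which is the shape that fixed-parameter
    tractability asks for. *)

Definition reach (P : program) (n : nat) (s s' : state) : Prop :=
  exists2 t, t <= n & iter t (step P) s = s'.

Lemma reach_trans P n1 n2 s1 s2 s3 :
  reach P n1 s1 s2 -> reach P n2 s2 s3 -> reach P (n1 + n2) s1 s3.
Proof.
move=> [t1 le1 <-] [t2 le2 <-]; exists (t2 + t1); first by rewrite addnC leq_add.
by rewrite iterD.
Qed.

Lemma reach_leq P n n' s s' : n <= n' -> reach P n s s' -> reach P n' s s'.
Proof. by move=> le [t let_ <-]; exists t => //; apply: leq_trans le. Qed.

Lemma reach0 P s : reach P 0 s s.
Proof. by exists 0. Qed.

Lemma reach_step P n s s' : reach P n (step P s) s' -> reach P n.+1 s s'.
Proof. by move=> [t le <-]; exists t.+1; rewrite ?ltnS // iterSr. Qed.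

Definition instr_at (P : program) (off : nat) (i : instr) : Prop :=
  onth P off = Some i.

(** Jump targets are absolute, so a fragment is not run in isolation but reasoned about at its place
    in the whole program. *)
Fixpoint code_at (P : program) (off : nat) (c : program) : Prop :=
  if c is i :: c' then instr_at P off i /\ code_at P off.+1 c' else True.

Lemma code_at_cat P off c1 c2 :
  code_at P off (c1 ++ c2) <->
  code_at P off c1 /\ code_at P (off + size c1) c2.
Proof.
elim: c1 off => [|i c1 IH] off /=; first by rewrite addn0; tauto.
by rewrite IH addSnnS; tauto.
Qed.

Lemma code_at_self pre c : code_at (pre ++ c) (size pre) c.
Proof.
elim: c pre => [//|i c IH] pre /=; split.
  by rewrite /instr_at onth_cat ltnn subnn.
by rewrite -cat_rcons -(size_rcons pre i); apply: IH.
Qed.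

(** Every loop has a bound that is evaluated before it starts, and memory is never written:
    evaluation is total and the memory can stay a parameter. *)
Inductive expr : Type :=
| Cst of nat
| Var of nat
| Plus of expr & expr
| Minus of expr & expr
| Read of expr
| If of expr & expr & expr
| Loop of expr & expr & expr.

Fixpoint loop (f : nat -> nat -> nat) (n a : nat) : nat :=
  if n is i.+1 then loop f i (f i a) else a.

(** Each round executes six instructions around the body; the final unit is the test that exits. *)
Fixpoint loop_cost (f cost : nat -> nat -> nat) (n a : nat) : nat :=
  if n is i.+1 then cost i a + 6 + loop_cost f cost i (f i a) else 1.

(** Variables are de Bruijn indices; in the body of [Loop n a b], which counts
  downwards, 0 is the loop index and 1 the accumulator. *)
Fixpoint eval (w : nat -> nat) (e : expr) (env : seq nat) : nat :=
  match e with
  | Cst v => v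
  | Var r => nth 0 env r
  | Plus a b => eval w a env + eval w b env
  | Minus a b => eval w a env - eval w b env
  | Read a => w (eval w a env)
  | If c a b => if eval w c env == 0 then eval w b env else eval w a env
  | Loop n a b =>
      loop (fun i acc => eval w b [:: i, acc & env]) (eval w n env) (eval w a env)
  end.

Fixpoint cost (w : nat -> nat) (e : expr) (env : seq nat) : nat :=
  match e with
  | Cst _ => 1
  | Var _ => 2
  | Plus a b | Minus a b => cost w a env + cost w b env + 1
  | Read a => cost w a env + 1
  | If c a b =>
      cost w c env + 3 + (if eval w c env == 0 then cost w b env else cost w a env)
  | Loop n a b =>
      cost w a env + cost w n env
      + loop_cost (fun i acc => eval w b [:: i, acc & env])
                  (fun i acc => cost w b [:: i, acc & env])
                  (eval w n env) (eval w a env)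
  end.

(** Compiling a jump requires the length of code that is not generated yet; this length depends
    neither on the offset nor on the registers. *)
Fixpoint csize (e : expr) : nat :=
  match e with
  | Cst _ => 1
  | Var _ => 2
  | Plus a b | Minus a b => csize a + csize b + 1
  | Read a => csize a + 1
  | If c a b => csize c + 1 + csize a + 2 + csize b
  | Loop n a b => csize a + csize n + 3 + csize b + 3
  end.

(** [rho] lists the registers holding the variables; the result goes to
  register [t], and only registers [>= t] are modified. *)
Fixpoint compile (e : expr) (off : nat) (rho : seq nat) (t : nat) : program :=
  match e with
  | Cst v => [:: IConst t v]
  | Var r =>
      [:: IConst t 0; if onth rho r is Some x then IAdd t t x else IConst t 0]
  | Plus a b =>
      compile a off rho t ++ compile b (off + csize a) rho t.+1
        ++ [:: IAdd t t t.+1]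
  | Minus a b =>
      compile a off rho t ++ compile b (off + csize a) rho t.+1
        ++ [:: ISub t t t.+1]
  | Read a => compile a off rho t ++ [:: ILoad t t]
  | If c a b =>
      compile c off rho t
        ++ [:: IJumpz t (off + csize c + 1 + csize a + 2)]
        ++ compile a (off + csize c + 1) rho t
        ++ [:: IConst t.+1 0;
               IJumpz t.+1 (off + csize c + 1 + csize a + 2 + csize b)]
        ++ compile b (off + csize c + 1 + csize a + 2) rho t
  | Loop n a b =>
      let start := off + csize a + csize n in
      compile a off rho t ++ compile n (off + csize a) rho t.+1
        ++ [:: IJumpz t.+1 (start + 3 + csize b + 3);
               IConst t.+2 1; ISub t.+1 t.+1 t.+2]
        ++ compile b (start + 3) [:: t.+1, t & rho] t.+2
        ++ [:: IConst t.+3 0; IAdd t t.+2 t.+3; IJumpz t.+3 start]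
  end.

Lemma size_compile e off rho t : size (compile e off rho t) = csize e.
Proof.
elim: e off rho t => //=.
- by move=> a IHa b IHb *; rewrite !size_cat IHa IHb /= addnA.
- by move=> a IHa b IHb *; rewrite !size_cat IHa IHb /= addnA.
- by move=> a IHa *; rewrite size_cat IHa.
- by move=> c IHc a IHa b IHb *; rewrite size_cat IHc /= size_cat IHa /= IHb; lia.
- move=> n IHn a IHa b IHb *; rewrite !size_cat IHa IHn /= size_cat IHb /=; lia.
Qed.

Lemma stepE P i s : instr_at P (pc s) i -> step P s = exec i s.
Proof. by rewrite /step => ->. Qed.

Lemma reach_instr P i off R w n s :
  instr_at P off i -> reach P n (exec i (State off R w)) s ->
  reach P n.+1 (State off R w) s.
Proof. by move=> Pi H; apply: reach_step; rewrite (stepE (i := i)). Qed.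

Lemma upd_same (R : nat -> nat) a v : upd R a v a = v.
Proof. by rewrite /upd eqxx. Qed.

Lemma upd_other (R : nat -> nat) a v x : x != a -> upd R a v x = R x.
Proof. by rewrite /upd => /negPf ->. Qed.

Lemma map_regs (R R' : nat -> nat) t rho :
  all (ltn^~ t) rho -> (forall x, x < t -> R' x = R x) -> map R' rho = map R rho.
Proof. by move=> /allP lt_rho E; apply/eq_in_map => x /lt_rho; apply: E. Qed.

Lemma all_ltnW t t' (rho : seq nat) :
  t <= t' -> all (ltn^~ t) rho -> all (ltn^~ t') rho.
Proof. by move=> le; apply: sub_all => x /= lt_x; apply: leq_trans le. Qed.

Ltac updE := rewrite ?upd_same ?(upd_other, upd_same) //; try by rewrite neq_ltn; lia.

Definition computes P off len rho t e w R :=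
  exists2 R', reach P (cost w e (map R rho)) (State off R w) (State (off + len) R' w)
    & R' t = eval w e (map R rho) /\ forall x, x < t -> R' x = R x.

(** Registers from [t] on serve as a stack, so a value in [t] survives an evaluation into [t.+1].
    The machine has no move and no unconditional jump: a copy is an addition to 0, a jump tests a
    register just set to 0. An unbound variable gives 0, in accordance with [nth 0]. *)
Lemma compile_correct P w e off rho t R :
  all (ltn^~ t) rho -> code_at P off (compile e off rho t) ->
  computes P off (csize e) rho t e w R.
Proof.
elim: e off rho t R => [v|r|a IHa b IHb|a IHa b IHb|a IHa|c IHc a IHa b IHb
  |n IHn a IHa b IHb] off rho t R lt_rho /=.
- move=> [Pi _]; exists (upd R t v).
    by apply: (reach_instr Pi); rewrite addn1; apply: reach0.
  by split=> [|x lt_x]; updE.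
- case onth_r: (onth rho r) => [x|] [Pi [Pj _]].
    have lt_x : x < t.
      by move/allP: lt_rho; apply; apply/onthP; exists r.
    exists (upd (upd R t 0) t (upd R t 0 t + upd R t 0 x)).
      by apply: (reach_instr Pi) => /=; apply: (reach_instr Pj); rewrite addn2; apply: reach0.
    have lt_r : r < size rho by rewrite -onthTE onth_r.
    split=> [|y lt_y]; last by updE.
    have := nth_map 0 0 R lt_r => /= ->.
    have -> : nth 0 rho r = x by apply: onth_nth.
    by updE.
  exists (upd (upd R t 0) t 0).
    by apply: (reach_instr Pi) => /=; apply: (reach_instr Pj); rewrite addn2; apply: reach0.
  split=> [|y lt_y]; last by updE.
  by rewrite [eval _ _ _]nth_default ?upd_same // size_map -onthNE onth_r.
- move=> /code_at_cat[Ca /code_at_cat[]]; rewrite !size_compile => Cb [Pi _].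
  have [Ra reach_a [Ra_t Ra_lt]] := IHa _ _ _ R lt_rho Ca.
  have [Rb reach_b [Rb_t Rb_lt]] := IHb _ _ _ Ra (all_ltnW (leqnSn t) lt_rho) Cb.
  rewrite (map_regs lt_rho Ra_lt) in reach_b Rb_t.
  exists (upd Rb t (Rb t + Rb t.+1)).
    rewrite !addnA; apply: reach_trans (reach_trans reach_a reach_b) _.
    by apply: (reach_instr Pi); rewrite /= addn1; apply: reach0.
  split=> [|x lt_x]; updE; first by rewrite Rb_lt ?Ra_t ?Rb_t.
  by rewrite Rb_lt ?Ra_lt //; lia.
- move=> /code_at_cat[Ca /code_at_cat[]]; rewrite !size_compile => Cb [Pi _].
  have [Ra reach_a [Ra_t Ra_lt]] := IHa _ _ _ R lt_rho Ca.
  have [Rb reach_b [Rb_t Rb_lt]] := IHb _ _ _ Ra (all_ltnW (leqnSn t) lt_rho) Cb.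
  rewrite (map_regs lt_rho Ra_lt) in reach_b Rb_t.
  exists (upd Rb t (Rb t - Rb t.+1)).
    rewrite !addnA; apply: reach_trans (reach_trans reach_a reach_b) _.
    by apply: (reach_instr Pi); rewrite /= addn1; apply: reach0.
  split=> [|x lt_x]; updE; first by rewrite Rb_lt ?Ra_t ?Rb_t.
  by rewrite Rb_lt ?Ra_lt //; lia.
- move=> /code_at_cat[Ca]; rewrite !size_compile => - [Pi _].
  have [Ra reach_a [Ra_t Ra_lt]] := IHa _ _ _ R lt_rho Ca.
  exists (upd Ra t (w (Ra t))).
    rewrite addnA; apply: reach_trans reach_a _.
    by apply: (reach_instr Pi); rewrite /= addn1; apply: reach0.
  by split=> [|x lt_x]; updE; [rewrite Ra_t | rewrite Ra_lt].
- move=> /code_at_cat[Cc]; rewrite size_compile /= => -[Pj]; rewrite -addn1.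
  move=> /code_at_cat[Ca]; rewrite size_compile /= => -[Pk [Pl]].
  rewrite -addn2 => Cb.
  have [Rc reach_c [Rc_t Rc_lt]] := IHc _ _ _ R lt_rho Cc.
  have [Ec|Ec] := eqVneq (eval w c (map R rho)) 0.
    have [Rb reach_b [Rb_t Rb_lt]] := IHb _ _ _ Rc lt_rho Cb.
    rewrite (map_regs lt_rho Rc_lt) in reach_b Rb_t.
    exists Rb.
      rewrite /= -[X in reach _ X]addnA; apply: reach_trans reach_c _.
      apply: (@reach_leq _ (cost w b (map R rho)).+1); first by rewrite Ec eqxx; lia.
      apply: (reach_instr Pj); rewrite /= Rc_t Ec eqxx.
      by move: reach_b; rewrite !addnA.
    by split=> [|x lt_x]; rewrite /= ?Ec ?eqxx // Rb_lt ?Rc_lt.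
  have [Ra reach_a [Ra_t Ra_lt]] := IHa _ _ _ Rc lt_rho Ca.
  rewrite (map_regs lt_rho Rc_lt) in reach_a Ra_t.
  exists (upd Ra t.+1 0).
    rewrite /= -[X in reach _ X]addnA; apply: reach_trans reach_c _.
    apply: (@reach_leq _ (cost w a (map R rho) + 2).+1); first by rewrite (negPf Ec); lia.
    apply: (reach_instr Pj); rewrite /= Rc_t (negPf Ec) -(addn1 (off + _)).
    apply: reach_trans reach_a _.
    apply: (reach_instr Pk) => /=; apply: (reach_instr Pl).
    by rewrite /= upd_same eqxx !addnA; apply: reach0.
  split=> [|x lt_x]; first by rewrite /= (negPf Ec); updE.
  by updE; rewrite Ra_lt ?Rc_lt.
move=> /code_at_cat[Ca]; rewrite size_compile => /code_at_cat[Cn].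
rewrite size_compile /= => -[Pj [Pc [Ps]]]; rewrite -addn3 => /code_at_cat[Cb].
rewrite size_compile /= => -[Pz [Pm [Pl _]]].
have [Ra reach_a [Ra_t Ra_lt]] := IHa _ _ _ R lt_rho Ca.
have [Rn reach_n [Rn_t Rn_lt]] := IHn _ _ _ Ra (all_ltnW (leqnSn t) lt_rho) Cn.
rewrite (map_regs lt_rho Ra_lt) in reach_n Rn_t.
set env := map R rho in reach_a Ra_t reach_n Rn_t *.
have{Ra_t} Rn_t0 : Rn t = eval w a env by rewrite Rn_lt.
have{Ra_lt} Rn_lt0 x : x < t -> Rn x = R x by move=> lt_x; rewrite Rn_lt ?Ra_lt //; lia.
have{Rn_lt}{reach_a reach_n} reach_start := reach_trans reach_a reach_n.
set start := off + csize a + csize n in Pj Pc Ps Cb Pz Pm Pl reach_start.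
suff [R' reach_l [R'_t R'_lt]] : exists2 R',
    reach P (loop_cost (fun i acc => eval w b [:: i, acc & env])
                       (fun i acc => cost w b [:: i, acc & env])
                       (eval w n env) (eval w a env))
          (State start Rn w) (State (start + 3 + csize b + 3) R' w)
  & R' t = loop (fun i acc => eval w b [:: i, acc & env])
                (eval w n env) (eval w a env)
    /\ forall x, x < t -> R' x = R x.
  exists R' => //.
  by move: (reach_trans reach_start reach_l); rewrite /start !addnA.
rewrite -Rn_t -Rn_t0; move En: (Rn t.+1) => i {reach_start Rn_t Rn_t0 Ca Cn}.
(* Induction on the counter in [t.+1], for every register state that agrees with [R] below [t]: the
   body may change all the other registers. *)
elim: i Rn En Rn_lt0 => [|i IHi] Q Q_i Q_lt.
  exists Q => //; apply: (reach_instr Pj).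
  by rewrite /= Q_i eqxx; apply: reach0.
set Q1 := upd (upd Q t.+2 1) t.+1 i.
have lt_rho' : all (ltn^~ t.+2) [:: t.+1, t & rho].
  by rewrite /= ltnS leqnSn ltnSn /=; apply: all_ltnW lt_rho; lia.
have [Q2 reach_b [Q2_t Q2_lt]] := IHb _ _ _ Q1 lt_rho' Cb.
have Q1env : map Q1 [:: t.+1, t & rho] = [:: i, Q t & env].
  rewrite /= {1 2}/Q1; congr [:: _, _ & _]; rewrite /upd ?eqxx //.
    by rewrite !ifN_eqC //; lia.
  apply: (map_regs lt_rho) => x lt_x.
  by rewrite /Q1 !upd_other ?Q_lt //; lia.
rewrite Q1env in reach_b Q2_t.
set Q3 := upd (upd Q2 t.+3 0) t (Q2 t.+2).
have [||R' reach_l H'] := IHi Q3.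
- by rewrite /Q3 !upd_other ?Q2_lt //; [rewrite /Q1 upd_same | lia | lia].
- move=> x lt_x; rewrite /Q3 !upd_other ?Q2_lt /Q1 ?upd_other ?Q_lt //; lia.
have Q3_t : Q3 t = eval w b [:: i, Q t & env] by rewrite /Q3 upd_same.
rewrite Q3_t in reach_l H'.
exists R' => //.
rewrite [loop_cost _ _ _ _]/=.
set loop_i := loop_cost _ _ i _ in reach_l *.
apply: (@reach_leq _ (cost w b [:: i, Q t & env] + loop_i.+3).+3); first by lia.
apply: (reach_instr Pj); rewrite /= Q_i /=.
apply: (reach_instr Pc) => /=; apply: (reach_instr Ps).
rewrite /= upd_same upd_other ?Q_i; last by lia.
rewrite subn1 /= -(addn3 start); apply: reach_trans reach_b _.
apply: (reach_instr Pz) => /=; apply: (reach_instr Pm) => /=; apply: (reach_instr Pl).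
rewrite /= [upd _ t _ t.+3]upd_other; last by lia.
rewrite !upd_same eqxx /=.
by rewrite [upd _ _ _ t.+2]upd_other ?addn0 //; lia.
Qed.

(** For [i = n - 1, ..., 0], store [val] at address [addr]; variable 0 is [i]. *)
Definition compile_for (n addr val : expr) (off : nat) (rho : seq nat) (t : nat) :
    program :=
  let start := off + csize n in
  compile n off rho t
    ++ [:: IJumpz t (start + 3 + csize addr + csize val + 3);
           IConst t.+1 1; ISub t t t.+1]
    ++ compile addr (start + 3) (t :: rho) t.+1
    ++ compile val (start + 3 + csize addr) (t :: rho) t.+2
    ++ [:: IStore t.+1 t.+2; IConst t.+1 0; IJumpz t.+1 start].

Definition csize_for (n addr val : expr) : nat :=
  csize n + 3 + csize addr + csize val + 3.

Lemma size_compile_for n addr val off rho t :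
  size (compile_for n addr val off rho t) = csize_for n addr val.
Proof. by rewrite !size_cat !size_compile /= /csize_for; lia. Qed.

(** The memory changes during this loop, so values and costs are controlled through an invariant
    [Q i], which describes the memory once the indices from [i] on are done. *)
Lemma compile_for_correct P n addr val off rho t R w
    (Q : nat -> (nat -> nat) -> Prop) K :
    let env := map R rho in
    all (ltn^~ t) rho -> code_at P off (compile_for n addr val off rho t) ->
    (forall i w', i < eval w n env -> Q i.+1 w' ->
       cost w' addr (i :: env) + cost w' val (i :: env) <= K /\
       Q i (upd w' (eval w' addr (i :: env)) (eval w' val (i :: env)))) ->
    Q (eval w n env) w ->
  exists R' w',
    [/\ reach P (cost w n env + eval w n env * (K + 6) + 1)
          (State off R w) (State (off + csize_for n addr val) R' w'),
        Q 0 w' & forall x, x < t -> R' x = R x].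
Proof.
move=> env lt_rho /code_at_cat[Cn]; rewrite size_compile /= => -[Pj [Pc [Ps]]].
rewrite -addn3 => /code_at_cat[Ca]; rewrite size_compile => /code_at_cat[Cv].
rewrite size_compile /= => -[Pt [Pz [Pl _]]].
have [Rn reach_n [Rn_t Rn_lt]] := compile_correct w R lt_rho Cn.
rewrite -/env in reach_n Rn_t; set start := off + csize n in Pj Pc Ps Ca Cv Pt Pz Pl reach_n.
move=> Qstep Qn.
suff loop_ok : forall i Rn w', Rn t = i -> (forall x, x < t -> Rn x = R x) ->
    i <= eval w n env -> Q i w' -> exists R' w'',
    [/\ reach P (i * (K + 6) + 1) (State start Rn w')
              (State (off + csize_for n addr val) R' w''),
        Q 0 w'' & forall x, x < t -> R' x = R x].
  have [R' [w' [reach_l Q0 R'_lt]]] := loop_ok _ _ _ Rn_t Rn_lt (leqnn _) Qn.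
  by exists R', w'; split=> //; rewrite -addnA; apply: reach_trans reach_n _.
elim=> [|i IHi] {Rn_t reach_n Cn Qn}{}Rn {Rn_lt} w' Q_i Rn_lt le_i Qi.
  exists Rn, w'; split=> //; rewrite mul0n; apply: (reach_instr Pj).
  by rewrite /= Q_i eqxx /start /csize_for !addnA; apply: reach0.
have [cost_i Qi'] := Qstep i w' le_i Qi.
set R1 := upd (upd Rn t.+1 1) t i.
have lt_rho1 : all (ltn^~ t.+1) (t :: rho).
  by rewrite /= ltnSn; apply: all_ltnW lt_rho; lia.
have R1env : map R1 (t :: rho) = i :: env.
  rewrite /= {1}/R1 upd_same; congr (_ :: _); apply: (map_regs lt_rho) => x lt_x.
  by rewrite /R1 !upd_other ?Rn_lt //; lia.
have [R2 reach_a [R2_t R2_lt]] := compile_correct w' R1 lt_rho1 Ca.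
have [R3 reach_v [R3_t R3_lt]] :=
  compile_correct w' R2 (all_ltnW (leqnSn _) lt_rho1) Cv.
rewrite (map_regs lt_rho1 R2_lt) R1env in reach_v R3_t.
rewrite R1env in reach_a R2_t.
set w1 := upd w' (R3 t.+1) (R3 t.+2).
set R4 := upd R3 t.+1 0.
have Ew1 : w1 = upd w' (eval w' addr (i :: env)) (eval w' val (i :: env)).
  by rewrite /w1 R3_t R3_lt ?R2_t.
rewrite -Ew1 in Qi'.
have [||R' [w'' [reach_l Q0 R'_lt]]] := IHi R4 w1 _ _ (ltnW le_i) Qi'.
- rewrite /R4 upd_other; last by lia.
  by rewrite R3_lt ?R2_lt ?/R1 ?upd_same //; lia.
- move=> x lt_x; rewrite /R4 upd_other; last by lia.
  rewrite R3_lt ?R2_lt /R1 ?upd_other ?Rn_lt //; lia.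
exists R', w''; split=> //.
apply: (@reach_leq _ ((cost w' addr (i :: env) + (cost w' val (i :: env)
   + (i * (K + 6) + 1).+3)).+3)); first by lia.
apply: (reach_instr Pj); rewrite /= Q_i /=.
apply: (reach_instr Pc) => /=; apply: (reach_instr Ps).
rewrite /= upd_same upd_other ?Q_i; last by lia.
rewrite subn1 /= -(addn3 start); apply: reach_trans reach_a _.
apply: reach_trans reach_v _.
apply: (reach_instr Pt) => /=; apply: (reach_instr Pz) => /=.
by apply: (reach_instr Pl); rewrite /= upd_same eqxx.
Qed.

(** Runs [search] (variable 0: the input length), then [len] (variables: the
  result of [search], the input length), and writes the values of [out]
  (variables: the position, then the values of [len] and [search], and the
  input length), first behind the input, which [out] may read, and then to the
  beginning of the memory. *)
Definition compile_main (search len out : expr) : program :=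
  let off1 := csize search in
  let off2 := off1 + csize len in
  let dest := Plus (Var 3) (Var 0) in
  let off3 := off2 + csize_for (Var 0) dest out in
  compile search 0 [:: 0] 1 ++ compile len off1 [:: 1; 0] 2
    ++ compile_for (Var 0) dest out off2 [:: 2; 1; 0] 3
    ++ compile_for (Var 0) (Var 0) (Read dest) off3 [:: 2; 1; 0] 3
    ++ [:: IConst 0 0; IAdd 0 0 2].

(** [out] still reads the input while its values are stored behind it, so it may depend on the first
    [L] cells only. In the final copy to the front, [l <= L] keeps the target disjoint from the
    source. *)
Lemma compile_main_correct search len out (inp : seq nat) g l (o : nat -> nat) K :
  let L := size inp in
  eval (nth 0 inp) search [:: L] = g ->
  eval (nth 0 inp) len [:: g; L] = l ->
  l <= L ->
  (forall w i, i < l -> (forall p, p < L -> w p = nth 0 inp p) ->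
     eval w out [:: i; l; g; L] = o i /\ cost w out [:: i; l; g; L] <= K) ->
  exists2 t, t <= cost (nth 0 inp) search [:: L] + cost (nth 0 inp) len [:: g; L]
                  + l * (K + 40) + 10
    & outputs_in (compile_main search len out) inp t (mkseq o l).
Proof.
move=> L Eg El le_lL Eout; set P := compile_main _ _ _.
have := code_at_self [::] P; rewrite {2}/P => /code_at_cat[Cs].
rewrite size_compile => /code_at_cat[Cl]; rewrite size_compile.
move=> /code_at_cat[C1]; rewrite size_compile_for => /code_at_cat[C2].
rewrite size_compile_for => -[Pz [Pa _]].
move: Cs Cl C1 C2 Pz Pa; rewrite !add0n => Cs Cl C1 C2 Pz Pa.
have [R1 reach_s [R1_t R1_lt]] :=
  @compile_correct _ (nth 0 inp) _ _ [:: 0] 1 (regs (init_state inp)) isT Cs.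
have R1_0 : R1 0 = L by rewrite R1_lt.
rewrite [map _ _]/= -/L in reach_s R1_t; rewrite Eg in R1_t.
have [R2 reach_l [R2_t R2_lt]] :=
  @compile_correct _ (nth 0 inp) _ _ [:: 1; 0] 2 R1 isT Cl.
rewrite [map _ _]/= R1_t R1_0 in reach_l R2_t; rewrite El in R2_t.
have R2_0 : R2 0 = L by rewrite R2_lt ?R1_0.
have R2_1 : R2 1 = g by rewrite R2_lt ?R1_t.
pose Q1 i w := (forall p, p < L -> w p = nth 0 inp p)
  /\ (forall p, i <= p < l -> w (L + p) = o p).
have [||R3 [w3 [reach_1 [Q1a Q1b] R3_lt]]] :=
    @compile_for_correct P _ _ _ _ [:: 2; 1; 0] 3 R2 (nth 0 inp) Q1 (K + 10) isT C1.
- rewrite /= R2_t R2_0 R2_1 => i w' lt_i [Qa Qb]; have [Eo Co] := Eout w' i lt_i Qa.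
  split; first by lia.
  split=> [p lt_p|p /andP[le_ip lt_p]]; rewrite /upd; first by rewrite ifN ?Qa //; lia.
  rewrite eqn_add2l; case: eqP => [->//|ne_p].
  by apply: Qb; rewrite lt_p andbT; lia.
- rewrite /= R2_t; split=> // p; lia.
have R3_0 : R3 0 = L by rewrite R3_lt.
have R3_2 : R3 2 = l by rewrite R3_lt.
pose Q2 i w := (forall p, p < i -> w (L + p) = o p)
  /\ (forall p, i <= p < l -> w p = o p).
have [||R4 [w4 [reach_2 [Q2a Q2b] R4_lt]]] :=
    @compile_for_correct P _ _ _ _ [:: 2; 1; 0] 3 R3 w3 Q2 10 isT C2.
- rewrite /= R3_2 R3_0 => i w' lt_i [Qa Qb]; split=> //.
  split=> [p lt_p|p /andP[le_ip lt_p]]; rewrite /upd.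
    by rewrite ifN; [apply: Qa; lia | lia].
  case: eqP => [->|ne_p]; first by apply: Qa.
  by apply: Qb; rewrite lt_p andbT; lia.
- rewrite /= R3_2; split=> p; last by lia.
  by move=> lt_p; apply: Q1b; rewrite lt_p.
have R4_2 : R4 2 = l by rewrite R4_lt.
have size_P : size P = (csize search + csize len
    + csize_for (Var 0) (Plus (Var 3) (Var 0)) out
    + csize_for (Var 0) (Var 0) (Read (Plus (Var 3) (Var 0)))).+2.
  rewrite /P /compile_main; do 4 rewrite size_cat ?size_compile ?size_compile_for.
  by rewrite [size _]/=; lia.
have [t le_t Et] : reach P (cost (nth 0 inp) search [:: L] + cost (nth 0 inp) len [:: g; L]
   + l * (K + 40) + 10) (init_state inp)
   (State (size P) (upd (upd R4 0 0) 0 l) w4).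
  rewrite /= R2_t in reach_1; rewrite /= R3_2 in reach_2.
  apply: reach_leq (reach_trans reach_s (reach_trans reach_l (reach_trans reach_1
    (reach_trans reach_2 (n2 := 2) _)))).
    by rewrite upd_same; lia.
  apply: (reach_instr Pz) => /=; apply: (reach_instr Pa) => /=.
  by rewrite upd_same upd_other // R4_2 add0n size_P; apply: reach0.
exists t => //; rewrite /outputs_in /halted /output Et /= leqnn upd_same; split=> //.
by apply/eq_in_map => p; rewrite mem_iota add0n => lt_p; apply: Q2b.
Qed.

(** * Structure of the solutions *)

(** A source map [s] replaces each row [y] by the row [s y]; [dl] is the
  distance between rows, so that [dl x y = 0] means that the rows are equal.
  [cnt s v i] and [sz s v] count the rows (of color [i]) equal to [v] after the
  replacement. *)
Section Algorithm.
Variables (m k r : nat) (dl : nat -> nat -> nat) (clr : nat -> nat).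
Implicit Types (s d : nat -> nat).

Definition cnt s v i := \sum_(y < m) ((dl v (s y) == 0) && (clr y == i)).
Definition sz s v := \sum_(y < m) (dl v (s y) == 0).
Definition ncolour i := \sum_(y < m) (clr y == i).
(** The fairness equation is multiplied by [m] to stay within natural numbers, and the colors are
    those of actual rows. *)
Definition fair_at s v :=
  [forall z : 'I_m, cnt s v (clr z) * m == ncolour (clr z) * sz s v].
(** The row of least index represents its cluster, so that sums over such rows count clusters. *)
Definition first_row v := [forall z : 'I_m, (z < v) ==> (dl v z != 0)].
Definition valid s :=
  [&& [forall x : 'I_m, fair_at s (s x)],
      \sum_(x < m) dl x (s x) <= k
    & \sum_(v < m) (first_row v && (0 < sz s v)) <= r].

(** [idx] numbers the unfair clusters. In the guess [d], entry [j < 2 * k] is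
  the size gained by cluster [j], shifted by [k], and entry [2 * k + l] is the
  destination of the row of rank [l] among the rows that leave their cluster. *)
Definition unfair v := ~~ fair_at id v.
Definition idx v :=
  \sum_(y < m) (unfair y && first_row y
                && [forall z : 'I_m, (z <= y) ==> (dl v z != 0)]).
Definition rnk x := \sum_(y < m) ((y < x) && (dl x y == 0) && (clr y == clr x)).
(** With [sz id x + d (idx x) - k] as the guessed size, fairness prescribes a new number of rows
    colored like [x]; the row leaves if its rank is below the decrease of that number. The
    inequality is multiplied by [m] and rearranged to avoid division and negative numbers. *)
Definition leave d x :=
  unfair x && (rnk x * m + ncolour (clr x) * (sz id x + d (idx x) - k)
               < cnt id x (clr x) * m).
Definition leave_rank d x := \sum_(y < m) ((y < x) && leave d y).
(** Any row of the cluster numbered [e] serves as destination; 0 is the value for a number that no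
    cluster has. *)
Definition dst e := loop (fun z a => if unfair z && (idx z == e) then z else a) m 0.
Definition source d x := if leave d x then dst (d (2 * k + leave_rank d x)) else x.

Hypothesis dlxx : forall x, dl x x = 0.
Hypothesis dlC : forall x y, dl x y = dl y x.
Hypothesis dl_triangle : forall y x z, dl x z <= dl x y + dl y z.

(** * Rows at distance zero are interchangeable *)

Lemma dl0_l x y z : dl x y = 0 -> dl x z = dl y z.
Proof.
move=> E; apply/eqP; rewrite eqn_leq.
have := dl_triangle y x z; have := dl_triangle x y z; rewrite (dlC y x) E.
by rewrite !add0n => -> ->.
Qed.

Lemma dl0_r x y z : dl x y = 0 -> dl z x = dl z y.
Proof. by rewrite ![dl z _]dlC; apply: dl0_l. Qed.

Lemma eq_cnt s s' v v' i :
  dl v v' = 0 -> (forall y, y < m -> dl (s y) (s' y) = 0) -> cnt s v i = cnt s' v' i.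
Proof.
by move=> Ev Es; apply: eq_bigr => y _; rewrite (dl0_l _ Ev) (dl0_r _ (Es y _)).
Qed.

Lemma eq_sz s s' v v' :
  dl v v' = 0 -> (forall y, y < m -> dl (s y) (s' y) = 0) -> sz s v = sz s' v'.
Proof.
by move=> Ev Es; apply: eq_bigr => y _; rewrite (dl0_l _ Ev) (dl0_r _ (Es y _)).
Qed.

Lemma eq_fair_at s s' v v' :
  dl v v' = 0 -> (forall y, y < m -> dl (s y) (s' y) = 0) ->
  fair_at s v = fair_at s' v'.
Proof.
move=> Ev Es; apply: eq_forallb => z.
by rewrite (eq_cnt _ Ev Es) (eq_sz Ev Es).
Qed.

(** This is why a destination need only be guessed as a cluster, not as a row. *)
Lemma valid_ext s s' :
  (forall y, y < m -> dl (s y) (s' y) = 0) -> valid s -> valid s'.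
Proof.
move=> Es /and3P[/forallP fair_s cost_s rows_s]; apply/and3P; split.
- by apply/forallP => x; rewrite -(eq_fair_at (Es x (ltn_ord x)) Es).
- by rewrite (eq_bigr (fun x : 'I_m => dl x (s x))) // => x _; rewrite (dl0_r _ (Es _ _)).
by under eq_bigr => v _ do rewrite -(eq_sz (dlxx v) Es).
Qed.

(** * Normalizing a solution by exchanges *)

Definition moved s x := dl x (s x) != 0.
(** Decreases under the two exchanges that make a source map [nice]. *)
Definition potential s := \sum_(x < m) (if moved s x then x.+1 else 0).

Definition swap (a b y : nat) := if y == a then b else if y == b then a else y.

(** Reindexing by a transposition that preserves colors. Both [cnt] and [sz] have this form, so an
    exchange affects only the cost. *)
Lemma sum_swap (a b : 'I_m) s (F : nat -> nat -> nat) :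
  clr a = clr b ->
  \sum_(y < m) F (s (swap a b y)) (clr y) = \sum_(y < m) F (s y) (clr y).
Proof.
move=> Ecol; rewrite [RHS](reindex_inj (@perm_inj _ (tperm a b))).
apply: eq_bigr => y _; rewrite /swap; case: tpermP => [->|->|ya yb].
- by rewrite eqxx Ecol.
- by rewrite eqxx Ecol; case: eqP => // ->.
by rewrite !ifN //; apply/eqP => /val_inj.
Qed.

Lemma leq_sum2 (a b : 'I_m) (F G : 'I_m -> nat) :
  a != b -> (forall y, y != a -> y != b -> F y = G y) ->
  (F a + F b <= G a + G b -> \sum_y F y <= \sum_y G y) /\
  (F a + F b < G a + G b -> \sum_y F y < \sum_y G y).
Proof.
move=> neq E.
have split_sum H : \sum_y H y = H a + (H b + \sum_(y | (y != a) && (y != b)) H y).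
  by rewrite (bigD1 a) //= (bigD1 b) // eq_sym.
rewrite !split_sum; under eq_bigr => y /andP[ya yb] do rewrite E //.
by lia.
Qed.

Lemma valid_swap (a b : 'I_m) s :
  clr a = clr b -> a != b ->
  dl a (s b) + dl b (s a) <= dl a (s a) + dl b (s b) ->
  valid s -> valid (s \o swap a b).
Proof.
move=> Ecol neq le_cost /and3P[/forallP fair_s cost_s rows_s].
have Esz v : sz (s \o swap a b) v = sz s v.
  exact: (sum_swap s (fun x _ => dl v x == 0)).
have Ecnt v i : cnt (s \o swap a b) v i = cnt s v i.
  exact: (sum_swap s (fun x c => (dl v x == 0) && (c == i))).
have Efair v : fair_at (s \o swap a b) v = fair_at s v.
  by apply: eq_forallb => z; rewrite Esz Ecnt.
apply/and3P; split.
- apply/forallP => x; rewrite Efair /= /swap.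
  by case: ifP => _; [|case: ifP => _].
- apply: leq_trans cost_s.
  have [|le_sum _] := @leq_sum2 a b (fun x => dl x ((s \o swap a b) x))
    (fun x => dl x (s x)) neq.
    by move=> y ya yb /=; rewrite /swap !ifN.
  apply: le_sum; rewrite /= /swap !eqxx; case: eqP => [/val_inj E|_] //.
  by rewrite E eqxx in neq.
by under eq_bigr => v _ do rewrite Esz.
Qed.

Lemma potential_swap (a b : 'I_m) s :
  a != b ->
  (if dl a (s b) != 0 then a.+1 else 0) + (if dl b (s a) != 0 then b.+1 else 0)
    < (if moved s a then a.+1 else 0) + (if moved s b then b.+1 else 0) ->
  potential (s \o swap a b) < potential s.
Proof.
move=> neq lt_ab; have [|_] := @leq_sum2 a b
  (fun x => if moved (s \o swap a b) x then x.+1 else 0)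
  (fun x => if moved s x then x.+1 else 0) neq.
  by move=> y ya yb; rewrite /moved /= /swap (ifN _ _ ya) (ifN _ _ yb).
apply; rewrite /moved /= /swap !eqxx [nat_of_ord b == _](_ : _ = false) //.
by rewrite eq_sym; apply: negbTE.
Qed.

Definition nice s : Prop :=
  (forall a b : 'I_m, clr a = clr b -> moved s a -> moved s b -> dl b (s a) <> 0) /\
  (forall a b : 'I_m, clr a = clr b -> dl a b = 0 -> b < a -> moved s a -> moved s b).

(** Each violation is repaired by an exchange. If [a] moves into the cluster that [b] leaves, then
    [b] stays and [a] takes over the destination of [b]; the triangle inequality through [b] bounds
    the cost, and at least [b] ceases to be moved. If [a] moves while an equal earlier row [b]
    stays, they trade roles at equal cost. Weighting moved rows by their index makes [potential]
    decrease in the second case too. *)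
Lemma exists_nice s :
  (forall x, x < m -> s x < m) -> valid s ->
  exists s', [/\ forall x, x < m -> s' x < m, valid s' & nice s'].
Proof.
have [n] := ubnP (potential s); elim: n s => // n IH s lt_n s_lt valid_s.
have swap_ok (a b : 'I_m) : clr a = clr b -> a != b ->
  dl a (s b) + dl b (s a) <= dl a (s a) + dl b (s b) ->
  (if dl a (s b) != 0 then a.+1 else 0) + (if dl b (s a) != 0 then b.+1 else 0)
    < (if moved s a then a.+1 else 0) + (if moved s b then b.+1 else 0) ->
  exists s', [/\ forall x, x < m -> s' x < m, valid s' & nice s'].
  move=> Ecol neq le_cost lt_pot; apply: (IH (s \o swap a b)).
  - by apply: leq_trans (potential_swap neq lt_pot) _; rewrite -ltnS.
  - by move=> x lt_x /=; apply: s_lt; rewrite /swap; case: ifP => // _; case: ifP.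
  - exact: valid_swap.
case E1: [exists a : 'I_m, exists b : 'I_m,
    [&& clr a == clr b, moved s a, moved s b & dl b (s a) == 0]].
  move/existsP: E1 => [a /existsP[b /and4P[/eqP Ecol mv_a mv_b /eqP Eba]]].
  apply: (swap_ok a b) => //.
  - by apply: contraNneq mv_a => E; rewrite {1}E; apply/eqP.
  - by rewrite Eba addn0 (dl0_l (s b) Eba) dl_triangle.
  by rewrite Eba mv_a mv_b /=; case: ifP; lia.
case E2: [exists a : 'I_m, exists b : 'I_m,
    [&& clr a == clr b, dl a b == 0, b < a, moved s a & ~~ moved s b]].
  move/existsP: E2 => [a /existsP[b /and5P[/eqP Ecol /eqP Eab lt_ba mv_a mv_b]]].
  move: (mv_b); rewrite negbK => /eqP Eb.
  apply: (swap_ok a b) => //.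
  - by apply: contraTneq lt_ba => ->; rewrite ltnn.
  - by rewrite (dl0_l (s b) Eab) Eb -(dl0_l (s a) Eab) add0n addn0.
  rewrite mv_a (negPf mv_b) (dl0_l (s b) Eab) Eb -(dl0_l (s a) Eab) /=.
  by case: ifP; lia.
exists s; split=> //; split.
  move=> a b Ecol mv_a mv_b Eba; move/existsP: E1; case; exists a.
  by apply/existsP; exists b; rewrite Ecol Eba mv_a mv_b !eqxx.
move=> a b Ecol Eab lt_ba mv_a; apply: contraT => mv_b.
move/existsP: E2; case; exists a.
by apply/existsP; exists b; rewrite Ecol Eab lt_ba mv_a mv_b !eqxx.
Qed.


(** * Numbering of the unfair clusters *)

Lemma first_rowP v : v < m ->
  exists u : 'I_m, [/\ first_row u, dl v u = 0 & forall z, z < u -> dl v z <> 0].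
Proof.
move=> lt_v; have ex_z : exists z, (z < m) && (dl v z == 0).
  by exists v; rewrite lt_v dlxx eqxx.
case: (ex_minnP ex_z) => u /andP[lt_u /eqP Eu] min_u.
have min_v z : z < u -> dl v z <> 0.
  move=> lt_z /eqP Ez; have := min_u z; rewrite Ez (ltn_trans lt_z lt_u) => /(_ isT).
  by rewrite leqNgt lt_z.
exists (Ordinal lt_u); split=> //; apply/forallP => z; apply/implyP => /= /min_v.
by rewrite (dl0_l z Eu) => /eqP.
Qed.

Lemma first_row_uniq v : \sum_(u < m) (first_row u && (dl u v == 0)) <= 1.
Proof.
rewrite -big_mkcond /= sum1_card; apply/card_le1_eqP => u u'.
rewrite !unfold_in => /andP[/forallP Fu /eqP Eu] /andP[/forallP Fu' /eqP Eu'].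
have E : dl u u' = 0 by rewrite (dl0_l u' Eu) dlC.
have [lt_u|lt_u|/val_inj//] := ltngtP u u'.
  by have := Fu' u; rewrite lt_u dlC E eqxx.
by have := Fu u'; rewrite lt_u E eqxx.
Qed.

(** The value of [idx] read off at the representative [u] of a cluster; in this form, strict
    monotonicity on the representatives of unfair clusters is visible. *)
Definition idx_sum u := \sum_(y < m) (unfair y && first_row y && (y < u)).

Lemma idxE v (u : 'I_m) :
  dl v u = 0 -> (forall z, z < u -> dl v z <> 0) -> idx v = idx_sum u.
Proof.
move=> Eu min_u; apply: eq_bigr => y _; congr (nat_of_bool (_ && _)).
apply/forallP/idP => [H|lt_y z].
  by have := H u; rewrite Eu eqxx implybF -ltnNge.
by apply/implyP => le_z; apply/eqP/min_u/(leq_ltn_trans le_z).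
Qed.

Lemma unfair_first v (u : 'I_m) :
  unfair v -> dl v u = 0 -> first_row u -> unfair u && first_row u.
Proof.
move=> uv Eu ->; rewrite andbT; move: uv; rewrite /unfair (@eq_fair_at id id v u) //.
Qed.

Lemma idx_sum_lt (u u' : 'I_m) :
  unfair u && first_row u -> u < u' -> idx_sum u < idx_sum u'.
Proof.
move=> Fu lt_u; rewrite /idx_sum [X in _ < X](bigD1 u) //= lt_u Fu add1n ltnS.
rewrite (bigD1 u) //= ltnn andbF add0n; apply: leq_sum => y _.
by case: (unfair y && _) => //=; case: (ltnP y u) => //= lt_y; rewrite (ltn_trans lt_y lt_u).
Qed.

Lemma idx_inj v v' : v < m -> v' < m -> unfair v -> unfair v' ->
  idx v = idx v' -> dl v v' = 0.
Proof.
move=> /first_rowP[u [Fu Eu min_u]] /first_rowP[u' [Fu' Eu' min_u']] uv uv'.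
rewrite (idxE Eu min_u) (idxE Eu' min_u') => E.
have [lt_u|lt_u|/val_inj Euu] := ltngtP u u'.
- by have := idx_sum_lt (unfair_first uv Eu Fu) lt_u; rewrite E ltnn.
- by have := idx_sum_lt (unfair_first uv' Eu' Fu') lt_u; rewrite E ltnn.
by rewrite (dl0_l _ Eu) dlC Euu.
Qed.

(** The search has a hit, namely [v], and by [idx_inj] every hit lies in the cluster of [v]. *)
Lemma dstP v : v < m -> unfair v -> dl (dst (idx v)) v = 0.
Proof.
move=> lt_v uv; have loopP (P : pred nat) n a : (exists2 z, z < n & P z) \/ P a /\ a < m ->
    n <= m -> P (loop (fun z a => if P z then z else a) n a)
    /\ loop (fun z a => if P z then z else a) n a < m.
  elim: n a => [|n IH] a /= H le_n; first by case: H => [[]|].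
  apply: IH (ltnW le_n); case: ifP => [Pn|nPn]; first by right.
  case: H => [[z lt_z Pz]|]; last by right.
  left; exists z => //; rewrite ltn_neqAle -ltnS lt_z andbT.
  by apply: contraFneq nPn => <-.
have [|/andP[ud /eqP Ed] lt_d] :=
    loopP (fun z => unfair z && (idx z == idx v)) m 0 _ (leqnn m).
  by left; exists v => //; rewrite uv eqxx.
exact: idx_inj.
Qed.

(** * Rows entering and leaving the clusters in a normalized solution *)

Section Completeness.
Variable s : nat -> nat.
Hypothesis s_lt : forall x, x < m -> s x < m.
Hypothesis valid_s : valid s.
Hypothesis nice_s : nice s.
Hypothesis m_gt0 : 0 < m.
Variable c : nat.
Hypothesis k_lt_c : k < c.
Hypothesis dvd_c : forall t, (forall z : 'I_m, m %| ncolour (clr z) * t) -> c %| t.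

Definition out v i :=
  \sum_(y < m) ((dl v y == 0) && (clr y == i) && moved s y).
Definition into v i :=
  \sum_(y < m) ((dl v (s y) == 0) && (clr y == i) && moved s y).

Lemma unmoved_dl v y : ~~ moved s y -> dl v (s y) = dl v y.
Proof. by rewrite negbK => /eqP E; rewrite (dl0_r v E). Qed.

Lemma cnt_balance v i : cnt id v i + into v i = cnt s v i + out v i.
Proof.
rewrite -!big_split; apply: eq_bigr => y _ /=.
have [mv|/(unmoved_dl v) ->] := boolP (moved s y); last by rewrite !andbF.
by rewrite !andbT addnC.
Qed.

Lemma into_eq0 v i : 0 < out v i -> into v i = 0.
Proof.
rewrite lt0n sum_nat_eq0 => /forallPn[b]; rewrite eqb0 negbK.
move=> /andP[/andP[/eqP Eb /eqP Cb] mv_b].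
apply: big1 => a _; apply/eqP; rewrite eqb0; apply/negP.
move=> /andP[/andP[/eqP Ea /eqP Ca] mv_a].
case: nice_s => + _ => /(_ a b); apply=> //; first by rewrite Ca Cb.
by rewrite -(dl0_l (s a) Eb).
Qed.

Lemma moved_cost : \sum_(y < m) moved s y <= k.
Proof.
case/and3P: valid_s => _ + _; apply: leq_trans; apply: leq_sum => y _.
by rewrite /moved; case: (dl _ _).
Qed.

Lemma sz_leq v : sz id v <= sz s v + k /\ sz s v <= sz id v + k.
Proof.
split; apply: leq_trans (leq_add (leqnn _) moved_cost); rewrite -big_split.
  apply: leq_sum => y _ /=; have [mv|/(unmoved_dl v) ->] := boolP (moved s y).
    by rewrite addn1 (leq_trans (leq_b1 _)).
  by rewrite addn0.
apply: leq_sum => y _ /=; have [mv|/(unmoved_dl v) ->] := boolP (moved s y).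
  by rewrite addn1 (leq_trans (leq_b1 _)).
by rewrite addn0.
Qed.

Lemma cnt_leq_sz v i : cnt s v i <= sz s v.
Proof. by apply: leq_sum => y _; case: (_ == _); case: (_ == _). Qed.

(** [valid] speaks of the rows in the image of [s]; for any other [v], the new cluster is empty and
    both sides vanish. *)
Lemma fair_s v (z : 'I_m) : cnt s v (clr z) * m = ncolour (clr z) * sz s v.
Proof.
have [E|] := posnP (sz s v).
  by have := cnt_leq_sz v (clr z); rewrite E leqn0 => /eqP ->; rewrite muln0.
rewrite lt0n sum_nat_eq0 => /forallPn[y]; rewrite eqb0 negbK => /eqP Ey.
case/and3P: valid_s => /forallP/(_ y)/forallP/(_ z)/eqP + _ _.
by rewrite (@eq_cnt s s _ _ _ Ey) // (@eq_sz s s _ _ Ey).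
Qed.

(** Both sizes are multiples of [c] and differ by at most [k], hence agree. Fairness then gives
    equal color counts, so as many rows of a color enter as leave, and [into_eq0] excludes that both
    numbers are positive. *)
Lemma fair_untouched v (z : 'I_m) :
  ~~ unfair v -> out v (clr z) = 0 /\ into v (clr z) = 0.
Proof.
rewrite negbK => /forallP fair_v.
have dvd1 : c %| sz id v.
  by apply: dvd_c => z'; have := fair_v z' => /eqP <-; apply: dvdn_mull.
have dvd2 : c %| sz s v by apply: dvd_c => z'; rewrite -fair_s dvdn_mull.
have Esz : sz s v = sz id v.
  have [le1 le2] := sz_leq v.
  have [le|/ltnW le] := leqP (sz s v) (sz id v).
    have := dvdn_leq _ (dvdn_sub dvd1 dvd2); lia.
  have := dvdn_leq _ (dvdn_sub dvd2 dvd1); lia.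
have /eqP Ecnt : cnt s v (clr z) == cnt id v (clr z).
  by rewrite -(eqn_pmul2r m_gt0) fair_s Esz; have := fair_v z; rewrite eq_sym.
have := cnt_balance v (clr z); have := @into_eq0 v (clr z); rewrite Ecnt.
by case: (out _ _) => [|o] H E; [|rewrite H // in E]; split=> //; lia.
Qed.

Lemma out_gt0 (x : 'I_m) : moved s x -> 0 < out x (clr x).
Proof.
move=> mv; rewrite lt0n sum_nat_eq0; apply/forallPn; exists x.
by rewrite dlxx !eqxx mv.
Qed.

Lemma moved_unfair (x : 'I_m) : moved s x -> unfair x /\ unfair (s x).
Proof.
move=> mv; split; apply: contraT => fair_x.
  by have [] := fair_untouched x fair_x; have := out_gt0 mv; lia.
have [_ /eqP] := fair_untouched x fair_x; rewrite sum_nat_eq0 => /forallP/(_ x).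
by rewrite dlxx !eqxx mv.
Qed.

(** A cluster that no moved row touches already has its final counts, which are fair. *)
Lemma unfair_touched v : unfair v ->
  exists2 y : 'I_m, moved s y & (dl v y == 0) || (dl v (s y) == 0).
Proof.
move=> unf; case: (boolP [exists y : 'I_m, moved s y && ((dl v y == 0) || (dl v (s y) == 0))]).
  by case/existsP => y /andP[]; exists y.
move=> /existsPn H; case/negP: unf.
have E y : y < m -> (dl v y == 0) = (dl v (s y) == 0).
  move=> lt_y; have := H (Ordinal lt_y); rewrite negb_and /=.
  case/orP => [/(unmoved_dl v) -> //|]; rewrite negb_or => /andP[/negPf -> /negPf ->] //.
apply/forallP => z; have := fair_s v z.
have <- : cnt id v (clr z) = cnt s v (clr z) by apply: eq_bigr => y _; rewrite /= E.
by have <- : sz id v = sz s v; [apply: eq_bigr => y _; rewrite /= E | move->].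
Qed.

Lemma count_unfair : \sum_(v < m) (unfair v && first_row v) <= 2 * k.
Proof.
(* Each unfair cluster, counted at its first row, is charged to a moved row touching it. After
   exchanging the sums, a moved row is charged at most once for its origin and once for its
   destination. *)
apply: (@leq_trans (\sum_(v < m) \sum_(y < m) (moved s y *
   ((first_row v && (dl v y == 0)) + (first_row v && (dl v (s y) == 0)))))).
  apply: leq_sum => v _; case: andP => //= -[/unfair_touched[y mv E] ->].
  by rewrite (bigD1 y) //= mv mul1n; move: E; do 2 case: (_ == 0).
rewrite exchange_big /= mulnC; apply: leq_trans (leq_mul moved_cost (leqnn 2)).
rewrite big_distrl /=; apply: leq_sum => y _; rewrite -big_distrr leq_mul //=.
by rewrite big_split (leq_add (first_row_uniq y) (first_row_uniq (s y))).
Qed.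

Lemma idx_lt v : v < m -> unfair v -> idx v < 2 * k.
Proof.
move=> /first_rowP[u [Fu Eu min_u]] uv; rewrite (idxE Eu min_u).
apply: leq_trans count_unfair; rewrite [X in _ < X](bigD1 u) //=.
rewrite (unfair_first uv Eu Fu) add1n ltnS /idx_sum (bigD1 u) //= ltnn andbF add0n.
by apply: leq_sum => y _; case: (unfair y && first_row y); case: (y < u).
Qed.

(** * Recovering a normalized solution from its digits *)

Definition moved_rank x := \sum_(y < m) ((y < x) && moved s y).

Lemma moved_rank_lt (x x' : 'I_m) :
  moved s x -> x < x' -> moved_rank x < moved_rank x'.
Proof.
move=> mv lt_x; rewrite /moved_rank [X in _ < X](bigD1 x) //= lt_x mv add1n ltnS.
rewrite (bigD1 x) //= ltnn add0n; apply: leq_sum => y _.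
by case: (ltnP y x) => //= lt_y; rewrite (ltn_trans lt_y lt_x).
Qed.

Lemma moved_rank_inj (x x' : 'I_m) :
  moved s x -> moved s x' -> moved_rank x = moved_rank x' -> x = x'.
Proof.
move=> mv mv' E; have [lt_x|lt_x|/val_inj//] := ltngtP x x'.
  by have := moved_rank_lt mv lt_x; rewrite E ltnn.
by have := moved_rank_lt mv' lt_x; rewrite E ltnn.
Qed.

Lemma moved_rank_bound (x : 'I_m) : moved s x -> moved_rank x < k.
Proof.
move=> mv; apply: leq_trans moved_cost; rewrite [X in _ < X](bigD1 x) //= mv add1n ltnS.
rewrite /moved_rank (bigD1 x) //= ltnn add0n; apply: leq_sum => y _.
by case: (ltnP y x).
Qed.

(** By the second clause of [nice], the moved rows of one color form an initial segment of that
    color within their cluster. *)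
Lemma rnk_moved (x : 'I_m) : 0 < out x (clr x) -> moved s x = (rnk x < out x (clr x)).
Proof.
move=> out_x; case: nice_s => _ nice2.
have [mv|nmv] := boolP (moved s x); apply/esym.
  rewrite /rnk /out [X in _ < X](bigD1 x) //= dlxx !eqxx mv add1n ltnS.
  rewrite (bigD1 x) //= ltnn add0n; apply: leq_sum => y _.
  case: (ltnP y x) => //= lt_y; case: eqP => //= Ey; case: eqP => //= Ec.
  by rewrite (nice2 x y).
apply/negbTE; rewrite -leqNgt; apply: leq_sum => y _.
case: eqP => //= Ey; case: eqP => //= Ec; rewrite andbT.
have [mv|//] := boolP (moved s y); have [//|lt_x|E] := ltngtP y x.
  by rewrite (nice2 y x) ?(dlC y) in nmv.
by rewrite -(val_inj E) mv in nmv.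
Qed.

(** The guess that describes [s]. A size changes by at most [k] in either direction, so the shifted
    change lies between 0 and [2 * k]; destinations are below [2 * k]. This is the origin of the
    base [2 * k + 1]. Positions that denote nothing get 0. *)
Definition digit j :=
  if j < 2 * k then
    if [pick v : 'I_m | unfair v && (idx v == j)] is Some v
    then sz s v + k - sz id v else 0
  else
    if [pick x : 'I_m | moved s x && (moved_rank x == j - 2 * k)] is Some x
    then idx (s x) else 0.

Lemma digit_bound j : digit j < 2 * k + 1.
Proof.
rewrite /digit; case: ifP => lt_j; case: pickP => [v|_]; rewrite ?addn1 //.
  by move=> _; have [] := sz_leq v; lia.
move=> /andP[mv _]; have [_ uv] := moved_unfair mv.
by have := idx_lt (s_lt (ltn_ord v)) uv; lia.
Qed.

Lemma digit_target (v : 'I_m) : unfair v -> sz id v + digit (idx v) - k = sz s v.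
Proof.
move=> uv; rewrite /digit (idx_lt (ltn_ord v) uv); case: pickP => [v'|/(_ v)].
  move=> /andP[uv' /eqP /idx_inj E]; have {}E := E (ltn_ord _) (ltn_ord _) uv' uv.
  rewrite (@eq_sz s s _ _ E) // (@eq_sz id id _ _ E) //.
  by have [] := sz_leq v; lia.
by rewrite uv eqxx.
Qed.

Lemma digit_rank (x : 'I_m) : moved s x -> digit (2 * k + moved_rank x) = idx (s x).
Proof.
move=> mv; rewrite /digit ltnNge leq_addr /= addKn; case: pickP => [x'|/(_ x)].
  by move=> /andP[mv' /eqP /(moved_rank_inj mv' mv) ->].
by rewrite mv eqxx.
Qed.

Section Digits.
Variable d : nat -> nat.
Hypothesis d_digit : forall j, j < 3 * k -> d j = digit j.

(** With the true new size, the test compares [rnk x + cnt s x (clr x)] with the old count. If some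
    row of this color leaves, none enters, and the test reads [rnk x < out x (clr x)]; if none
    leaves, the count does not drop and the test fails. *)
Lemma leave_moved (x : 'I_m) : leave d x = moved s x.
Proof.
rewrite /leave; have [ux|fx] := boolP (unfair x) => /=; last first.
  apply/esym/negbTE; apply: contra fx => /moved_unfair[]//.
rewrite d_digit; last by apply: leq_trans (idx_lt (ltn_ord x) ux) _; lia.
rewrite (digit_target ux) -(fair_s x x) -mulnDl ltn_pmul2r //.
have [E0|out_x] := posnP (out x (clr x)); last first.
  rewrite rnk_moved //; have := cnt_balance x (clr x).
  by rewrite (into_eq0 out_x) addn0 => ->; rewrite addnC ltn_add2l.
have -> : moved s x = false.
  by case: (boolP (moved s x)) => // /out_gt0; rewrite E0.
by apply/negbTE; rewrite -leqNgt; have := cnt_balance x (clr x); lia.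
Qed.

Lemma valid_source : valid (source d).
Proof.
apply: valid_ext valid_s => y lt_y; set x := Ordinal lt_y.
rewrite /source (leave_moved x); have [mv|] := boolP (moved s y); last first.
  by rewrite negbK dlC => /eqP.
have [_ usx] := @moved_unfair x mv.
have -> : leave_rank d y = moved_rank y.
  by apply: eq_bigr => z _; rewrite leave_moved.
have lt_k : moved_rank y < k := @moved_rank_bound x mv.
rewrite d_digit; last by lia.
by rewrite (@digit_rank x mv) dlC; apply: dstP => //; apply: s_lt.
Qed.

End Digits.
End Completeness.

Lemma exists_digits s c :
  (forall x, x < m -> s x < m) -> valid s -> 0 < m -> k < c ->
  (forall t, (forall z : 'I_m, m %| ncolour (clr z) * t) -> c %| t) ->
  exists2 d, forall j, d j < 2 * k + 1 &
    forall d', (forall j, j < 3 * k -> d' j = d j) -> valid (source d').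
Proof.
move=> s_lt valid_s m_gt0 lt_kc dvd_c.
have [s' [s'_lt valid_s' nice_s']] := exists_nice s_lt valid_s.
exists (digit s') => [j|d' Ed]; first exact: digit_bound dvd_c _.
exact: valid_source dvd_c _ Ed.
Qed.

Lemma dst_lt e : 0 < m -> dst e < m.
Proof.
move=> m_gt0; rewrite /dst; move: (unfair) => P.
have : forall n a, n <= m -> a < m ->
  loop (fun z a => if P z && (idx z == e) then z else a) n a < m.
  by elim=> //= n IH a le_n lt_a; apply: IH (ltnW le_n) _; case: ifP.
exact.
Qed.

Lemma source_lt d x : x < m -> source d x < m.
Proof.
move=> lt_x; rewrite /source; case: ifP => // _.
by apply: dst_lt; apply: leq_ltn_trans lt_x.
Qed.

End Algorithm.

(** * The algorithm *)

(** Division as a bounded loop: the positive multiples of [n] up to [a] are counted, with [b] an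
    upper bound on the quotient. *)
Definition quotient (b n a : nat) : nat := \sum_(i < b) (i.+1 * n <= a).

Lemma quotientE b n a : 0 < n -> a %/ n <= b -> quotient b n a = a %/ n.
Proof.
move=> n_gt0 le_b; rewrite /quotient.
under eq_bigr => i _ do rewrite -leq_divRL //.
have sum_lt q b' : \sum_(i < b') (i < q) = minn b' q.
  elim: b' => [|b' IH]; first by rewrite big_ord0 min0n.
  by rewrite big_ord_recr /= IH; lia.
by rewrite sum_lt; lia.
Qed.

Section Digits.
Variables (bound base len : nat).

(** The number of rounds is fixed to [len], and only the last [j] of them, those with [t < j],
    divide by [base]. *)
Definition shifted (a j : nat) : nat :=
  loop (fun t a' => if t < j then quotient bound base a' else a') len a.
Definition digit_of (a j : nat) : nat :=
  shifted a j - base * quotient bound base (shifted a j).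

Lemma shiftedE a j : 0 < base -> a < bound -> j <= len -> shifted a j = a %/ base ^ j.
Proof.
move=> base_gt0 lt_a le_j; rewrite -{2}(minn_idPl le_j) /shifted.
elim: len a lt_a {le_j} => [|n IH] a lt_a /=; first by rewrite minn0 divn1.
have quotE : quotient bound base a = a %/ base.
  by rewrite quotientE // (leq_trans (leq_div _ _)) // ltnW.
case: ltnP => le_j.
  rewrite quotE IH ?(leq_ltn_trans (leq_div _ _)) //.
  by rewrite -divnMA -expnS; congr (_ %/ _ ^ _); lia.
by rewrite IH //; congr (_ %/ _ ^ _); lia.
Qed.

Lemma digit_ofE a j :
  0 < base -> a < bound -> j <= len -> digit_of a j = a %/ base ^ j %% base.
Proof.
move=> base_gt0 lt_a le_j; rewrite /digit_of shiftedE // quotientE //.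
  by rewrite {1}(divn_eq (a %/ base ^ j) base) mulnC addKn.
by do 2 rewrite (leq_trans (leq_div _ _)) //; apply: ltnW.
Qed.

Lemma exists_digit_of (d : nat -> nat) :
  0 < base -> (forall j, d j < base) -> base ^ len <= bound ->
  exists2 a, a < bound & forall j, j < len -> digit_of a j = d j.
Proof.
move=> base_gt0 lt_d le_bound.
have [a lt_a Ea] : exists2 a, a < base ^ len &
    forall j, j < len -> a %/ base ^ j %% base = d j.
  elim: len d lt_d => [|n IH] d lt_d {le_bound}; first by exists 0.
  have [a lt_a Ea] := IH (fun j => d j.+1) (fun j => lt_d j.+1).
  exists (a * base + d 0) => [|[|j] lt_j]; first by rewrite expnSr; have := lt_d 0; nia.
    by rewrite divn1 modnMDl modn_small.
  by rewrite expnS divnMA divnMDl // (divn_small (lt_d 0)) addn0 Ea.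
exists a => [|j lt_j]; first exact: leq_trans le_bound.
by rewrite digit_ofE ?Ea //; [exact: leq_trans le_bound | exact: ltnW].
Qed.

End Digits.

(** The functions below take as [w] the encoded instance, viewed as the initial
  memory: see [fdmc_encode]. *)
Definition entry (w : nat -> nat) x j := w (6 + x * w 1 + j).
Definition colour (w : nat -> nat) x := w (6 + w 0 * w 1 + x).
Definition hamming (w : nat -> nat) x y := \sum_(j < w 1) (entry w x j != entry w y j).
(** An upper bound on the number of digit sequences, in a shape that two doubling loops compute;
    [w 4] is the budget. *)
Definition guesses (w : nat -> nat) := 2 ^ 2 ^ (2 * w 4 + 3).
Definition guess (w : nat -> nat) a j :=
  digit_of (guesses w) (2 * w 4 + 1) (3 * w 4) a j.
Definition guessed_source (w : nat -> nat) a x :=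
  source (w 0) (w 4) (hamming w) (colour w) (guess w a) x.
Definition good_guess (w : nat -> nat) a :=
  valid (w 0) (w 4) (w 5) (hamming w) (colour w) (guessed_source w a).
(** The result is shifted by one: 0 means that no guess is good. *)
Definition search (w : nat -> nat) :=
  loop (fun a acc => if good_guess w a then a.+1 else acc) (guesses w) 0.
Definition output_size (w : nat -> nat) g := if g == 0 then 1 else 1 + w 0 * w 1.
Definition output_word (w : nat -> nat) g p :=
  if g == 0 then 0 else if p == 0 then 1 else
  entry w (guessed_source w (g - 1) (quotient (w 0) (w 1) (p - 1)))
    (p - 1 - quotient (w 0) (w 1) (p - 1) * w 1).

(** * Polynomial time evaluation *)

(** Weakening, which lets an expression be reused inside a loop body, where two variables are added
    in front. *)
Fixpoint rename (s : nat -> nat) (e : expr) : expr :=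
  match e with
  | Cst v => Cst v
  | Var r => Var (s r)
  | Plus a b => Plus (rename s a) (rename s b)
  | Minus a b => Minus (rename s a) (rename s b)
  | Read a => Read (rename s a)
  | If c a b => If (rename s c) (rename s a) (rename s b)
  | Loop n a b =>
      Loop (rename s n) (rename s a)
        (rename (fun r => if r is r'.+2 then (s r').+2 else r) b)
  end.

Lemma eq_loop f g n a : f =2 g -> loop f n a = loop g n a.
Proof. by move=> fg; elim: n a => //= n IH a; rewrite fg. Qed.

Lemma eq_loop_cost f g c d n a :
  f =2 g -> c =2 d -> loop_cost f c n a = loop_cost g d n a.
Proof. by move=> fg cd; elim: n a => //= n IH a; rewrite fg cd IH. Qed.

Lemma eval_rename w e s env env' :
  (forall r, nth 0 env' r = nth 0 env (s r)) ->
  eval w (rename s e) env = eval w e env' /\ cost w (rename s e) env = cost w e env'.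
Proof.
elim: e s env env' => //=.
- by move=> a IHa b IHb s env env' E; have [-> ->] := IHa _ _ _ E; have [-> ->] := IHb _ _ _ E.
- by move=> a IHa b IHb s env env' E; have [-> ->] := IHa _ _ _ E; have [-> ->] := IHb _ _ _ E.
- by move=> a IHa s env env' E; have [-> ->] := IHa _ _ _ E.
- move=> c IHc a IHa b IHb s env env' E.
  by have [-> ->] := IHa _ _ _ E; have [-> ->] := IHb _ _ _ E; have [-> ->] := IHc _ _ _ E.
move=> n IHn a IHa b IHb s env env' E.
have [-> ->] := IHa _ _ _ E; have [-> ->] := IHn _ _ _ E.
have E' i acc r : nth 0 [:: i, acc & env'] r
    = nth 0 [:: i, acc & env] (if r is r'.+2 then (s r').+2 else r).
  by case: r => [|[|r]] //=; apply: E.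
split; first by apply: eq_loop => i acc; case: (IHb _ _ _ (E' i acc)).
by congr (_ + _); apply: eq_loop_cost => i acc; case: (IHb _ _ _ (E' i acc)).
Qed.

Lemma loop_cost_leq f c n a K :
  (forall i a', c i a' <= K) -> loop_cost f c n a <= n * (K + 6) + 1.
Proof.
move=> le_K; elim: n a => [//|n IH] a /=.
by have := IH (f n a); have := le_K n a; lia.
Qed.

Lemma loop_sum F n a : loop (fun i acc => acc + F i) n a = a + \sum_(i < n) F i.
Proof.
elim: n a => [|n IH] a /=; first by rewrite big_ord0 addn0.
by rewrite IH big_ord_recr /=; lia.
Qed.

Lemma loop_double n a : loop (fun _ acc => acc + acc) n a = a * 2 ^ n.
Proof. by elim: n a => [|n IH] a /=; rewrite ?muln1 // IH expnS; lia. Qed.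

(** * Closure properties of polynomial time evaluation *)

Section Computability.
Variables (X : Type) (inp : X -> seq nat) (N : X -> nat).
Hypothesis N_gt1 : forall x, 1 < N x.
Implicit Types b f g h : (nat -> nat) -> seq nat -> nat.

(** [f w env] is given by an expression that is evaluated in time polynomial
  in [N], even if the memory behind the input has been overwritten. *)
Definition ptime f : Prop :=
  exists e D, forall x w env,
    (forall p, p < size (inp x) -> w p = nth 0 (inp x) p) ->
    eval w e env = f (nth 0 (inp x)) env /\ cost w e env <= N x ^ D.

(** Required of loop bounds in addition to [ptime]: repeated doubling reaches exponentially large
    values in few steps. *)
Definition bounded f : Prop :=
  exists D, forall x env, f (nth 0 (inp x)) env <= N x ^ D.

Lemma leq_Nadd x (a b p q : nat) :
  a <= N x ^ p -> b <= N x ^ q -> a + b <= N x ^ (p + q).+1.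
Proof.
move=> le_a le_b; rewrite expnS expnD.
have Np : 0 < N x ^ p by rewrite expn_gt0 ltnW.
have Nq : 0 < N x ^ q by rewrite expn_gt0 ltnW.
apply: leq_trans (leq_mul (N_gt1 x) (leqnn _)); nia.
Qed.

Lemma leq_Ncst x c : c <= N x ^ c.
Proof. by apply/ltnW/ltn_expl. Qed.

Lemma leq_Nmul x (a b p q : nat) :
  a <= N x ^ p -> b <= N x ^ q -> a * b <= N x ^ (p + q).
Proof. by move=> le_a le_b; rewrite expnD leq_mul. Qed.

Lemma bounded_cst c : bounded (fun _ _ => c).
Proof. by exists c => x env; apply: leq_Ncst. Qed.

Lemma bounded_add f g : bounded f -> bounded g -> bounded (fun w env => f w env + g w env).
Proof.
move=> [p Hp] [q Hq]; exists (p + q).+1 => x env; exact: leq_Nadd.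
Qed.

Lemma bounded_mul f g : bounded f -> bounded g -> bounded (fun w env => f w env * g w env).
Proof.
move=> [p Hp] [q Hq]; exists (p + q) => x env; exact: leq_Nmul.
Qed.

Lemma ptime_ext f g :
  (forall x env, f (nth 0 (inp x)) env = g (nth 0 (inp x)) env) -> ptime f -> ptime g.
Proof.
move=> fg [e [D H]]; exists e, D => x w env Hw; rewrite -fg; exact: H.
Qed.

Lemma ptime_ren f : ptime f -> ptime (fun w env => f w (behead env)).
Proof.
move=> [e [D H]]; exists (rename succn e), D => x w env Hw.
have [|-> ->] := @eval_rename w e succn env (behead env).
  by move=> r; rewrite nth_behead.
exact: H.
Qed.

Lemma ptime_var r : ptime (fun _ env => nth 0 env r).
Proof. by exists (Var r), 2 => x w env _; split=> //; apply: leq_Ncst. Qed.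

Lemma ptime_cst c : ptime (fun _ _ => c).
Proof. by exists (Cst c), 1 => x w env _; split=> //; apply: leq_Ncst. Qed.

Lemma ptime_add f g : ptime f -> ptime g -> ptime (fun w env => f w env + g w env).
Proof.
move=> [e1 [p H1]] [e2 [q H2]]; exists (Plus e1 e2); eexists => x w env Hw.
have [E1 C1] := H1 x w env Hw; have [E2 C2] := H2 x w env Hw.
by split=> /=; [rewrite E1 E2 | exact: leq_Nadd (leq_Nadd C1 C2) (leq_Ncst _ _)].
Qed.

Lemma ptime_sub f g : ptime f -> ptime g -> ptime (fun w env => f w env - g w env).
Proof.
move=> [e1 [p H1]] [e2 [q H2]]; exists (Minus e1 e2); eexists => x w env Hw.
have [E1 C1] := H1 x w env Hw; have [E2 C2] := H2 x w env Hw.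
by split=> /=; [rewrite E1 E2 | exact: leq_Nadd (leq_Nadd C1 C2) (leq_Ncst _ _)].
Qed.

Lemma ptime_ifz h f g : ptime h -> ptime f -> ptime g ->
  ptime (fun w env => if h w env == 0 then g w env else f w env).
Proof.
move=> [e0 [r H0]] [e1 [p H1]] [e2 [q H2]]; exists (If e0 e1 e2).
eexists => x w env Hw; have [E0 C0] := H0 x w env Hw.
have [E1 C1] := H1 x w env Hw; have [E2 C2] := H2 x w env Hw.
split=> /=; first by rewrite E0 E1 E2.
apply: leq_Nadd (leq_Nadd C0 (leq_Ncst _ _)) _.
apply: leq_trans (leq_Nadd C1 C2).
by case: ifP => _; [exact: leq_addl | exact: leq_addr].
Qed.

(** [behead (behead env)] is the environment outside the loop. The cost of the body is bounded
    uniformly in the environment, hence whatever the accumulator has become. *)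
Lemma ptime_loop b g (body : (nat -> nat) -> seq nat -> nat -> nat -> nat) :
  ptime b -> bounded b -> ptime g ->
  ptime (fun w env => body w (behead (behead env)) (nth 0 env 0) (nth 0 env 1)) ->
  ptime (fun w env => loop (body w env) (b w env) (g w env)).
Proof.
move=> [e0 [r H0]] [n Hn] [e1 [p H1]] [e2 [q H2]]; exists (Loop e0 e1 e2).
eexists => x w env Hw; have [E0 C0] := H0 x w env Hw.
have [E1 C1] := H1 x w env Hw.
have H i acc := H2 x w [:: i, acc & env] Hw.
split=> /=; first by rewrite E0 E1; apply: eq_loop => i acc; case: (H i acc).
apply: leq_Nadd (leq_Nadd C1 C0) _.
apply: leq_trans (loop_cost_leq _ _ _ (K := N x ^ q) _) _.
  by move=> i acc; case: (H i acc).
apply: leq_Nadd (leq_Ncst _ _).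
by apply: leq_Nmul; [rewrite E0; apply: Hn | apply: leq_Nadd (leqnn _) (leq_Ncst _ _)].
Qed.

Lemma ptime_sum b (g : (nat -> nat) -> seq nat -> nat -> nat) :
  ptime b -> bounded b ->
  ptime (fun w env => g w (behead (behead env)) (nth 0 env 0)) ->
  ptime (fun w env => \sum_(i < b w env) g w env i).
Proof.
move=> ptime_b bound_b ptime_g.
apply: (@ptime_ext (fun w env => loop (fun i acc => acc + g w env i) (b w env) 0)).
  by move=> x env; rewrite loop_sum.
apply: (ptime_loop (body := fun w env i acc => acc + g w env i)) => //.
  exact: ptime_cst.
exact: ptime_add (ptime_var 1) ptime_g.
Qed.

(** Multiplication is repeated addition, so the first factor is a loop bound. *)
Lemma ptime_mul f g : bounded f -> ptime f -> ptime g ->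
  ptime (fun w env => f w env * g w env).
Proof.
move=> bound_f ptime_f ptime_g.
apply: (@ptime_ext (fun w env => \sum_(i < f w env) g w env)).
  by move=> x env; rewrite sum_nat_const card_ord.
apply: (ptime_sum (g := fun w env _ => g w env)) => //.
exact: ptime_ren (ptime_ren ptime_g).
Qed.

Lemma ptime_neg (P : (nat -> nat) -> seq nat -> bool) :
  ptime (fun w env => P w env) -> ptime (fun w env => ~~ P w env).
Proof.
move=> ptime_P; apply: (ptime_ext _ (ptime_sub (ptime_cst 1) ptime_P)) => x env.
by case: (P _ _).
Qed.

Lemma ptime_if (P : (nat -> nat) -> seq nat -> bool) f g :
  ptime (fun w env => P w env) -> ptime f -> ptime g ->
  ptime (fun w env => if P w env then f w env else g w env).
Proof.
move=> ptime_P ptime_f ptime_g; apply: (ptime_ext _ (ptime_ifz ptime_P ptime_f ptime_g)).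
by move=> x env; case: (P _ _).
Qed.

Lemma ptime_and (P Q : (nat -> nat) -> seq nat -> bool) :
  ptime (fun w env => P w env) -> ptime (fun w env => Q w env) ->
  ptime (fun w env => P w env && Q w env).
Proof.
move=> ptime_P ptime_Q; apply: (ptime_ext _ (ptime_if ptime_P ptime_Q (ptime_cst 0))).
by move=> x env; case: (P _ _).
Qed.

Lemma ptime_imply (P Q : (nat -> nat) -> seq nat -> bool) :
  ptime (fun w env => P w env) -> ptime (fun w env => Q w env) ->
  ptime (fun w env => P w env ==> Q w env).
Proof.
move=> ptime_P ptime_Q; apply: (ptime_ext _ (ptime_if ptime_P ptime_Q (ptime_cst 1))).
by move=> x env; case: (P _ _).
Qed.

Lemma ptime_leq f g : ptime f -> ptime g -> ptime (fun w env => f w env <= g w env).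
Proof.
move=> ptime_f ptime_g.
apply: (ptime_ext _ (ptime_ifz (ptime_sub ptime_f ptime_g) (ptime_cst 0) (ptime_cst 1))).
by move=> x env; rewrite -/(leq _ _); case: leq.
Qed.

Lemma ptime_ltn f g : ptime f -> ptime g -> ptime (fun w env => f w env < g w env).
Proof.
move=> ptime_f ptime_g.
apply: (ptime_ext _ (ptime_leq (ptime_add ptime_f (ptime_cst 1)) ptime_g)).
by move=> x env; rewrite addn1.
Qed.

Lemma ptime_eq f g : ptime f -> ptime g -> ptime (fun w env => f w env == g w env).
Proof.
move=> ptime_f ptime_g.
apply: (ptime_ext _ (ptime_and (ptime_leq ptime_f ptime_g) (ptime_leq ptime_g ptime_f))).
by move=> x env; rewrite eqn_leq.
Qed.

Lemma ptime_forall b (P : (nat -> nat) -> seq nat -> nat -> bool) :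
  ptime b -> bounded b ->
  ptime (fun w env => P w (behead (behead env)) (nth 0 env 0)) ->
  ptime (fun w env => [forall i : 'I_(b w env), P w env i]).
Proof.
move=> ptime_b bound_b ptime_P.
have ptime_S : ptime (fun w env => \sum_(i < b w env) ~~ P w env i).
  apply: (ptime_sum (g := fun w env i => ~~ P w env i)) => //.
  exact: ptime_neg.
apply: (ptime_ext _ (ptime_eq ptime_S (ptime_cst 0))) => x env; congr nat_of_bool.
rewrite sum_nat_eq0; apply: eq_forallb => i; case: (P _ _ _) => //.
Qed.

(** * Polynomial time evaluation of the search and of the output *)

Hypothesis size_inp : forall x,
  size (inp x) = 6 + nth 0 (inp x) 0 * nth 0 (inp x) 1 + nth 0 (inp x) 0.
Hypothesis bounded0 : bounded (fun w _ => w 0).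
Hypothesis bounded1 : bounded (fun w _ => w 1).
Hypothesis bounded4 : bounded (fun w _ => w 4).
Hypothesis bounded_guesses : bounded (fun w _ => guesses w).
Lemma ptime_header p : p < 6 -> ptime (fun w _ => w p).
Proof.
move=> lt_p; exists (Read (Cst p)), 2 => x w env Hw /=.
by split; [rewrite Hw // size_inp; lia | apply: leq_Ncst].
Qed.

(** Cells behind the input may have been overwritten by the output, so the address is first compared
    with the input length; beyond it, the value is the default 0 of [nth]. *)
Lemma ptime_memory f : ptime f -> ptime (fun w env => w (f w env)).
Proof.
move=> ptime_f; have [e [p He]] := ptime_f.
have [e' [p' He']] : ptime (fun w env => f w env < 6 + w 0 * w 1 + w 0).
  apply: (ptime_ltn (g := fun w env => 6 + w 0 * w 1 + w 0)) => //.
  apply: ptime_add => //; last exact: ptime_header.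
  apply: ptime_add; first exact: ptime_cst.
  by apply: ptime_mul => //; exact: ptime_header.
exists (If e' (Read e) (Cst 0)).
eexists => x w env Hw; have [E C] := He x w env Hw; have [E' C'] := He' x w env Hw.
rewrite -size_inp in E'; split=> /=; last first.
  apply: leq_Nadd (leq_Nadd C' (leq_Ncst _ _)) _.
  apply: leq_trans (leq_Nadd C (leq_Ncst _ 1)).
  by case: ifP => _; rewrite ?addn1.
rewrite E' E; case: ltnP => [/Hw //|le_f] /=; by rewrite nth_default.
Qed.

Ltac ptime_leaf :=
  solve [ assumption | exact: ptime_cst | exact: ptime_var | exact: ptime_header
  | match goal with H : ptime _ |- _ =>
      first [ exact: (ptime_ren H) | exact: (ptime_ren (ptime_ren H))
            | exact: (ptime_ren (ptime_ren (ptime_ren H)))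
            | exact: (ptime_ren (ptime_ren (ptime_ren (ptime_ren H)))) ]
    end
  | exact: (ptime_ren (ptime_ren (ptime_var _)))].

Lemma ptime_entry f g : ptime f -> ptime g -> ptime (fun w env => entry w (f w env) (g w env)).
Proof.
move=> ptime_f ptime_g; apply: ptime_memory; apply: ptime_add => //; apply: ptime_add => //.
  exact: ptime_cst.
apply: (ptime_ext _ (ptime_mul bounded1 (@ptime_header 1 isT) ptime_f)) => // x env.
exact: mulnC.
Qed.

Lemma ptime_colour f : ptime f -> ptime (fun w env => colour w (f w env)).
Proof.
move=> ptime_f; apply: ptime_memory; apply: ptime_add => //; apply: ptime_add => //.
  exact: ptime_cst.
by apply: ptime_mul => //; apply: ptime_header.
Qed.

Lemma ptime_hamming f g :
  ptime f -> ptime g -> ptime (fun w env => hamming w (f w env) (g w env)).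
Proof.
move=> ptime_f ptime_g.
apply: (ptime_sum (g := fun w env j => entry w (f w env) j != entry w (g w env) j)) => //.
  exact: ptime_header.
apply: ptime_neg => //; apply: ptime_eq => //; apply: ptime_entry; ptime_leaf.
Qed.

Lemma ptime_ncolour f : ptime f -> ptime (fun w env => ncolour (w 0) (colour w) (f w env)).
Proof.
move=> ptime_f.
apply: (ptime_sum (g := fun w env y => colour w y == f w env)) => //.
  exact: ptime_header.
by apply: ptime_eq; [apply: ptime_colour|]; ptime_leaf.
Qed.

Section Sources.
Variables (s : (nat -> nat) -> nat -> nat -> nat) (h : (nat -> nat) -> seq nat -> nat).
Hypothesis ptime_s : forall f g, ptime f -> ptime g ->
  ptime (fun w env => s w (f w env) (g w env)).
Hypothesis ptime_h : ptime h.

Lemma ptime_cnt f g : ptime f -> ptime g -> ptime (fun w env =>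
  cnt (w 0) (hamming w) (colour w) (s w (h w env)) (f w env) (g w env)).
Proof.
move=> ptime_f ptime_g.
apply: (ptime_sum (g := fun w env y =>
  (hamming w (f w env) (s w (h w env) y) == 0) && (colour w y == g w env))) => //.
  exact: ptime_header.
apply: ptime_and; apply: ptime_eq; try ptime_leaf.
  apply: ptime_hamming; first by ptime_leaf.
  by apply: (ptime_s (f := fun w env => h w (behead (behead env)))); ptime_leaf.
by apply: ptime_colour; ptime_leaf.
Qed.

Lemma ptime_sz f : ptime f -> ptime (fun w env =>
  sz (w 0) (hamming w) (s w (h w env)) (f w env)).
Proof.
move=> ptime_f.
apply: (ptime_sum (g := fun w env y => hamming w (f w env) (s w (h w env) y) == 0)) => //.
  exact: ptime_header.
apply: ptime_eq; try ptime_leaf; apply: ptime_hamming; first by ptime_leaf.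
by apply: (ptime_s (f := fun w env => h w (behead (behead env)))); ptime_leaf.
Qed.

End Sources.

Lemma ptime_fair_at s h f :
  (forall f g, ptime f -> ptime g -> ptime (fun w env => s w (f w env) (g w env))) ->
  ptime h -> ptime f ->
  ptime (fun w env =>
    fair_at (w 0) (hamming w) (colour w) (s w (h w env)) (f w env)).
Proof.
move=> ptime_s ptime_h ptime_f.
apply: (ptime_forall (P := fun w env z =>
  cnt (w 0) (hamming w) (colour w) (s w (h w env)) (f w env) (colour w z) * w 0
  == ncolour (w 0) (colour w) (colour w z)
     * sz (w 0) (hamming w) (s w (h w env)) (f w env))) => //.
  exact: ptime_header.
have ptime_z : ptime (fun w env => colour w (nth 0 env 0)).
  by apply: ptime_colour; ptime_leaf.
have ptime_h' : ptime (fun w env => h w (behead (behead env))) by ptime_leaf.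
have ptime_f' : ptime (fun w env => f w (behead (behead env))) by ptime_leaf.
apply: ptime_eq.
  apply: (ptime_ext _ (ptime_mul bounded0 (@ptime_header 0 isT)
    (ptime_cnt ptime_s ptime_h' ptime_f' ptime_z))) => x env.
  exact: mulnC.
apply: ptime_mul (ptime_sz ptime_s ptime_h' ptime_f').
  case: bounded0 => D H; exists D => x env; apply: leq_trans (H x env).
  rewrite -[X in _ <= X]card_ord -sum1_card; apply: leq_sum => y _; exact: leq_b1.
exact: ptime_ncolour.
Qed.

Lemma ptime_id f g : ptime f -> ptime g -> ptime (fun w env => id (g w env)).
Proof. by []. Qed.

Lemma ptime_unfair f : ptime f ->
  ptime (fun w env => unfair (w 0) (hamming w) (colour w) (f w env)).
Proof.
move=> ptime_f; apply: ptime_neg.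
exact: (ptime_fair_at (s := fun _ _ => id) ptime_id (ptime_cst 0) ptime_f).
Qed.

Lemma ptime_first_row f : ptime f ->
  ptime (fun w env => first_row (w 0) (hamming w) (f w env)).
Proof.
move=> ptime_f; apply: (ptime_forall (P := fun w env z =>
  (z < f w env) ==> (hamming w (f w env) z != 0))) => //; first exact: ptime_header.
apply: ptime_imply; first by apply: ptime_ltn; ptime_leaf.
by apply: ptime_neg; apply: ptime_eq; [apply: ptime_hamming|]; ptime_leaf.
Qed.

Lemma ptime_idx f : ptime f ->
  ptime (fun w env => idx (w 0) (hamming w) (colour w) (f w env)).
Proof.
move=> ptime_f; apply: (ptime_sum (g := fun w env y =>
  unfair (w 0) (hamming w) (colour w) y && first_row (w 0) (hamming w) y
  && [forall z : 'I_(w 0), (z <= y) ==> (hamming w (f w env) z != 0)])) => //.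
  exact: ptime_header.
apply: ptime_and.
  by apply: ptime_and; [apply: ptime_unfair | apply: ptime_first_row]; ptime_leaf.
apply: (ptime_forall (P := fun w env z => (z <= nth 0 env 0)
  ==> (hamming w (f w (behead (behead env))) z != 0))) => //; first exact: ptime_header.
apply: ptime_imply; first by apply: ptime_leq; ptime_leaf.
by apply: ptime_neg; apply: ptime_eq; [apply: ptime_hamming|]; ptime_leaf.
Qed.

Lemma ptime_rnk f : ptime f ->
  ptime (fun w env => rnk (w 0) (hamming w) (colour w) (f w env)).
Proof.
move=> ptime_f; apply: (ptime_sum (g := fun w env y =>
  (y < f w env) && (hamming w (f w env) y == 0) && (colour w y == colour w (f w env)))) => //.
  exact: ptime_header.
apply: ptime_and; first apply: ptime_and.
- by apply: ptime_ltn; ptime_leaf.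
- by apply: ptime_eq; [apply: ptime_hamming|]; ptime_leaf.
by apply: ptime_eq; apply: ptime_colour; ptime_leaf.
Qed.

Lemma ptime_guesses : ptime (fun w _ => guesses w).
Proof.
have ptime_pow2 b : ptime b -> bounded b -> ptime (fun w env => 2 ^ b w env).
  move=> ptime_b bounded_b.
  apply: (@ptime_ext (fun w env => loop (fun _ a => a + a) (b w env) 1)).
    by move=> x env; rewrite loop_double mul1n.
  apply: (ptime_loop (body := fun _ _ _ a => a + a)) => //; first exact: ptime_cst.
  by apply: ptime_add; exact: ptime_var.
apply: (ptime_pow2 (fun w _ => 2 ^ (2 * w 4 + 3))).
  apply: (ptime_pow2 (fun w _ => 2 * w 4 + 3)).
    apply: ptime_add; last exact: ptime_cst.
    apply: ptime_mul; [exact: bounded_cst | exact: ptime_cst | exact: ptime_header].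
  by apply: bounded_add; [apply: bounded_mul => //|]; apply: bounded_cst.
(* The exponent bounds the outer doubling loop and is itself below [guesses]. *)
case: bounded_guesses => D H; exists D => x env; apply: leq_trans (H x env).
by apply/ltnW/ltn_expl.
Qed.

Lemma ptime_quotient (b : (nat -> nat) -> nat) f g :
  ptime (fun w env => b w) -> bounded (fun w _ => b w) ->
  ptime f -> bounded f -> ptime g ->
  ptime (fun w env => quotient (b w) (f w env) (g w env)).
Proof.
move=> ptime_b bounded_b ptime_f [D bounded_f] ptime_g.
apply: (ptime_sum (g := fun w env i => i.+1 * f w env <= g w env)) => //.
apply: ptime_leq; last by ptime_leaf.
apply: (@ptime_ext (fun w env =>
  f w (behead (behead env)) * (nth 0 env 0 + 1))) => [x env|].
  by rewrite mulnC addn1.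
apply: ptime_mul; first by exists D => x env.
  by ptime_leaf.
by apply: ptime_add; [exact: ptime_var | exact: ptime_cst].
Qed.

Lemma bounded_base : bounded (fun w _ => 2 * w 4 + 1).
Proof.
by apply: bounded_add; [apply: bounded_mul => //|]; apply: bounded_cst.
Qed.

Lemma ptime_base : ptime (fun w _ => 2 * w 4 + 1).
Proof.
apply: ptime_add; last exact: ptime_cst.
by apply: ptime_mul; [exact: bounded_cst | exact: ptime_cst | exact: ptime_header].
Qed.

Lemma ptime_guess f g : ptime f -> ptime g ->
  ptime (fun w env => guess w (f w env) (g w env)).
Proof.
move=> ptime_f ptime_g.
have ptime_q h : ptime h -> ptime (fun w env => quotient (guesses w) (2 * w 4 + 1) (h w env)).
  move=> ptime_h; apply: (ptime_quotient (f := fun w _ => 2 * w 4 + 1)) => //.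
  - exact: ptime_guesses.
  - exact: ptime_base.
  exact: bounded_base.
have ptime_shifted : ptime (fun w env =>
    shifted (guesses w) (2 * w 4 + 1) (3 * w 4) (f w env) (g w env)).
  apply: (ptime_loop (b := fun w _ => 3 * w 4) (body := fun w env t a =>
    if t < g w env then quotient (guesses w) (2 * w 4 + 1) a else a)) => //.
  - by apply: ptime_mul; [exact: bounded_cst | exact: ptime_cst | exact: ptime_header].
  - by apply: bounded_mul => //; apply: bounded_cst.
  apply: (ptime_if (P := fun w env => nth 0 env 0 < g w (behead (behead env)))).
  - by apply: ptime_ltn; ptime_leaf.
  - by apply: ptime_q; exact: ptime_var.
  exact: ptime_var.
apply: ptime_sub => //; apply: ptime_mul; first exact: bounded_base.
  exact: ptime_base.
exact: ptime_q.
Qed.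

Lemma ptime_leave f g : ptime f -> ptime g -> ptime (fun w env =>
  leave (w 0) (w 4) (hamming w) (colour w) (guess w (f w env)) (g w env)).
Proof.
move=> ptime_f ptime_g; have ptime_m := @ptime_header 0 isT.
have ptime_c := ptime_colour ptime_g.
have ptime_i := ptime_idx ptime_g.
apply: ptime_and; first exact: ptime_unfair.
apply: ptime_ltn; last first.
  apply: (ptime_ext _ (ptime_mul bounded0 ptime_m
    (ptime_cnt (s := fun _ _ => id) ptime_id (ptime_cst 0) ptime_g ptime_c))) => x env.
  exact: mulnC.
apply: ptime_add.
  apply: (ptime_ext _ (ptime_mul bounded0 ptime_m (ptime_rnk ptime_g))) => x env.
  exact: mulnC.
apply: ptime_mul.
- case: bounded0 => D H; exists D => x env; apply: leq_trans (H x env).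
  by rewrite -[X in _ <= X]card_ord -sum1_card; apply: leq_sum => y _; exact: leq_b1.
- exact: ptime_ncolour.
apply: ptime_sub; last exact: ptime_header.
apply: ptime_add; last exact: ptime_guess.
exact: (ptime_sz (s := fun _ _ => id) ptime_id (ptime_cst 0) ptime_g).
Qed.

Lemma ptime_source f g : ptime f -> ptime g ->
  ptime (fun w env => guessed_source w (f w env) (g w env)).
Proof.
move=> ptime_f ptime_g.
have ptime_dst h : ptime h ->
    ptime (fun w env => dst (w 0) (hamming w) (colour w) (h w env)).
  move=> ptime_h; apply: (ptime_loop (b := fun w _ => w 0) (g := fun _ _ => 0)
    (body := fun w env z a => if unfair (w 0) (hamming w) (colour w) z
       && (idx (w 0) (hamming w) (colour w) z == h w env) then z else a)) => //.
  - exact: ptime_header.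
  - exact: ptime_cst.
  apply: (ptime_if (P := fun w env => unfair (w 0) (hamming w) (colour w) (nth 0 env 0)
    && (idx (w 0) (hamming w) (colour w) (nth 0 env 0) == h w (behead (behead env)))));
    try exact: ptime_var.
  apply: ptime_and; first by apply: ptime_unfair; exact: ptime_var.
  by apply: ptime_eq; [apply: ptime_idx|]; ptime_leaf.
apply: (ptime_if (P := fun w env => leave (w 0) (w 4) (hamming w) (colour w)
    (guess w (f w env)) (g w env))) => //; first exact: ptime_leave.
apply: ptime_dst; apply: ptime_guess => //; apply: ptime_add.
  by apply: ptime_mul; [exact: bounded_cst | exact: ptime_cst | exact: ptime_header].
apply: (ptime_sum (g := fun w env y => (y < g w env)
  && leave (w 0) (w 4) (hamming w) (colour w) (guess w (f w env)) y)) => //.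
  exact: ptime_header.
apply: ptime_and; first by apply: ptime_ltn; ptime_leaf.
by apply: (ptime_leave (f := fun w env => f w (behead (behead env)))); ptime_leaf.
Qed.

Lemma ptime_good_guess f : ptime f -> ptime (fun w env => good_guess w (f w env)).
Proof.
move=> ptime_f; have ptime_m := @ptime_header 0 isT.
have ptime_f' : ptime (fun w env => f w (behead (behead env))) by ptime_leaf.
have ptime_s := ptime_source ptime_f' (ptime_var 0).
apply: ptime_and; last apply: ptime_and.
- apply: (ptime_forall (P := fun w env x => fair_at (w 0) (hamming w) (colour w)
    (guessed_source w (f w env)) (guessed_source w (f w env) x))) => //.
  exact: (ptime_fair_at (s := guessed_source) ptime_source ptime_f' ptime_s).
- apply: ptime_leq; last exact: ptime_header.
  apply: (ptime_sum (g := fun w env x => hamming w x (guessed_source w (f w env) x))) => //.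
  exact: ptime_hamming (ptime_var 0) ptime_s.
apply: ptime_leq; last exact: ptime_header.
apply: (ptime_sum (g := fun w env v => first_row (w 0) (hamming w) v
  && (0 < sz (w 0) (hamming w) (guessed_source w (f w env)) v))) => //.
apply: ptime_and; first by apply: ptime_first_row; exact: ptime_var.
apply: ptime_ltn; first exact: ptime_cst.
exact: (ptime_sz (s := guessed_source) ptime_source ptime_f' (ptime_var 0)).
Qed.

Lemma ptime_search : ptime (fun w _ => search w).
Proof.
apply: (ptime_loop (b := fun w _ => guesses w) (g := fun _ _ => 0)
  (body := fun w env a acc => if good_guess w a then a.+1 else acc)) => //.
- exact: ptime_guesses.
- exact: ptime_cst.
apply: (ptime_if (P := fun w env => good_guess w (nth 0 env 0))).
- by apply: ptime_good_guess; exact: ptime_var.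
- apply: (ptime_ext _ (ptime_add (ptime_var 0) (ptime_cst 1))) => x env.
  by rewrite addn1.
exact: ptime_var.
Qed.

Lemma ptime_output_size f : ptime f -> ptime (fun w env => output_size w (f w env)).
Proof.
move=> ptime_f; apply: (ptime_if (P := fun w env => f w env == 0)).
- by apply: ptime_eq => //; exact: ptime_cst.
- exact: ptime_cst.
apply: ptime_add; first exact: ptime_cst.
by apply: ptime_mul => //; exact: ptime_header.
Qed.

Lemma ptime_output_word f g : ptime f -> ptime g ->
  ptime (fun w env => output_word w (f w env) (g w env)).
Proof.
move=> ptime_f ptime_g.
have ptime_p : ptime (fun w env => g w env - 1) by apply: ptime_sub => //; exact: ptime_cst.
have ptime_q : ptime (fun w env => quotient (w 0) (w 1) (g w env - 1)).
  by apply: (ptime_quotient (f := fun w _ => w 1)) => //; exact: ptime_header.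
apply: (ptime_if (P := fun w env => f w env == 0)).
- by apply: ptime_eq => //; exact: ptime_cst.
- exact: ptime_cst.
apply: (ptime_if (P := fun w env => g w env == 0)).
- by apply: ptime_eq => //; exact: ptime_cst.
- exact: ptime_cst.
apply: ptime_entry.
  by apply: ptime_source => //; apply: ptime_sub => //; exact: ptime_cst.
apply: ptime_sub => //.
apply: (ptime_ext _ (ptime_mul bounded1 (@ptime_header 1 isT) ptime_q)) => x env.
exact: mulnC.
Qed.

End Computability.

(** * Correctness *)

Lemma size_entries p m n (M : 'M['I_p]_(m, n)) : size (entries M) = m * n.
Proof. by rewrite size_allpairs !size_enum_ord. Qed.

Lemma nth_entries p m n (M : 'M['I_p]_(m, n)) (x : 'I_m) (j : 'I_n) :
  nth 0 (entries M) (x * n + j) = M x j.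
Proof.
rewrite /entries; have nth_pairs (s : seq 'I_m) i : i < size s ->
    nth 0 [seq (M i j : nat) | i <- s, j <- enum 'I_n] (i * n + j) = M (nth x s i) j.
  elim: s i => // x' s IH [|i] /= lt_i; rewrite nth_cat size_map size_enum_ord.
    by rewrite mul0n add0n ltn_ord (nth_map j) ?size_enum_ord // nth_ord_enum.
  rewrite ifN; last by rewrite -leqNgt mulSn -addnA leq_addr.
  by rewrite mulSn -addnA addKn IH.
by rewrite nth_pairs ?size_enum_ord // nth_ord_enum.
Qed.

(** * Clusters as classes of equal rows, and the fairlet size *)

Section Classes.
Variables (p m n c : nat) (M : 'M['I_p]_(m, n)) (gamma : m.-tuple 'I_c).
Hypothesis m_gt0 : 0 < m.

Definition class x := [set y | row y M == row x M].

Lemma cluster_class x : cluster M (class x).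
Proof.
apply/maxsetP; split.
  apply/forall_inP => y; rewrite inE => /eqP Ey; apply/forall_inP => z.
  by rewrite inE => /eqP Ez; rewrite Ey Ez.
move=> B /forall_inP HB sub; apply/eqP; rewrite eqEsubset sub andbT.
apply/subsetP => y By; rewrite inE; have := HB y By => /forall_inP; apply.
by apply: (subsetP sub); rewrite inE.
Qed.

Lemma clusterE S : cluster M S -> exists x, S = class x.
Proof.
case/maxsetP => /forall_inP HS maxS.
have [S0|[x Sx]] := set_0Vmem S; last first.
  exists x; apply/esym/maxS.
    by case/maxsetP: (cluster_class x).
  apply/subsetP => y Sy; rewrite inE; by have /forall_inP := HS y Sy; apply.
(* The empty set is contained in every class, so maximality identifies it with a class as well. *)
exists (Ordinal m_gt0); apply/esym/maxS; last by rewrite S0 sub0set.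
by case/maxsetP: (cluster_class (Ordinal m_gt0)).
Qed.

Lemma fairP : fair gamma M <-> forall x i,
  #|[set y in class x | tnth gamma y == i]| * m = color_count gamma i * #|class x|.
Proof.
have ratE (a b s : nat) :
    (a%:R = b%:R / m%:R * s%:R :> rat)%R <-> a * m = b * s.
  have m_neq0 : (m%:R != 0 :> rat)%R by rewrite Num.Theory.pnatr_eq0 -lt0n.
  rewrite -GRing.mulrAC -GRing.natrM; split => [E|<-].
    apply/eqP; rewrite -(Num.Theory.eqr_nat rat) GRing.natrM E.
    by rewrite GRing.divfK.
  by rewrite GRing.natrM GRing.mulfK.
split=> [fair_M x i|H S /clusterE[x ->] i]; last exact/ratE.
by apply/ratE; apply: fair_M; apply: cluster_class.
Qed.

Lemma color_countE i : color_count gamma i = \sum_(y < m) (tnth gamma y == i).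
Proof. by rewrite /color_count -sum1_count big_mkcond big_tuple. Qed.

(** [t * g] is the gcd of the products [t * color_count gamma i], all multiples of [m]; hence [m]
    divides [t * g], and [m %/ g] divides [t]. The division is exact since the color counts sum to
    [m]. *)
Lemma fairlet_dvd t : (forall z, m %| color_count gamma (tnth gamma z) * t) ->
  m %/ \big[gcdn/0]_(i < c) color_count gamma i %| t.
Proof.
move=> dvd_t; set g := \big[gcdn/0]_(i < c) _.
have dvd_g i : g %| color_count gamma i by rewrite /g; apply: biggcdn_inf (dvdnn _).
have sum_m : \sum_(i < c) color_count gamma i = m.
  under eq_bigr do rewrite color_countE.
  rewrite exchange_big /= -[RHS](card_ord m) -sum1_card; apply: eq_bigr => y _.
  rewrite (bigD1 (tnth gamma y)) //= eqxx big1 // => i.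
  by rewrite eq_sym => /negPf ->.
have dvd_gm : g %| m by rewrite -[X in _ %| X]sum_m; apply: dvdn_sum.
have g_gt0 : 0 < g := dvdn_gt0 m_gt0 dvd_gm.
rewrite -(dvdn_pmul2l g_gt0) mulnC divnK // mulnC.
have -> : t * g = \big[gcdn/0]_(i < c) (t * color_count gamma i).
  by rewrite (big_morph (muln t) (id1 := 0) (op1 := gcdn)) ?muln0 // => a b; rewrite muln_gcdr.
apply/dvdn_biggcdP => i _; rewrite mulnC.
have [->|] := posnP (color_count gamma i); first by rewrite mul0n.
rewrite color_countE lt0n sum_nat_eq0 => /forallPn[z]; rewrite eqb0 negbK => /eqP Ez.
by rewrite -color_countE -Ez.
Qed.

End Classes.

(** * Source maps and solutions of an instance *)

Section Instance.
Variable I : fdmc_instance.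
Hypothesis fairlet_gt : budget I < fairlet_size I.
Local Notation m := (nrows I).
Local Notation n := (ncols I).
Local Notation M := (mat I).
Local Notation w := (nth 0 (fdmc_encode I)).

Lemma nrows_gt0 : 0 < m.
Proof.
have [m0|//] := posnP m.
by move: fairlet_gt; rewrite /fairlet_size [X in X %/ _]m0 div0n.
Qed.

Lemma size_encode : size (fdmc_encode I) = 6 + m * n + m.
Proof. by rewrite !size_cat /= size_entries size_map size_tuple addnA. Qed.

Lemma entryE (x : 'I_m) (j : 'I_n) : entry w x j = M x j.
Proof.
rewrite /entry -addnA /fdmc_encode nth_cat ltnNge leq_addr /= addKn.
rewrite nth_cat size_entries ifT ?nth_entries //.
by apply: (@leq_trans (x.+1 * n)); rewrite ?leq_mul2r ?ltn_ord ?orbT // mulSn addnC ltn_add2r.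
Qed.

Lemma colourE (x : 'I_m) : colour w x = tnth (color I) x.
Proof.
rewrite /colour -addnA /fdmc_encode nth_cat ltnNge leq_addr /= addKn.
rewrite nth_cat size_entries ltnNge leq_addr /= addKn.
by rewrite (nth_map (tnth (color I) x)) ?size_tuple // -tnth_nth.
Qed.

Lemma hammingE (x y : 'I_m) : hamming w x y = \sum_(j < n) (M x j != M y j).
Proof. by apply: eq_bigr => j _; rewrite !entryE. Qed.

Lemma hamming_eq0 (x y : 'I_m) : (hamming w x y == 0) = (row x M == row y M).
Proof.
rewrite hammingE sum_nat_eq0; apply/forallP/eqP => [H|E j].
  by apply/rowP => j; have := H j; rewrite !mxE eqb0 negbK => /eqP.
by have /rowP/(_ j) := E; rewrite !mxE => ->; rewrite eqxx.
Qed.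

Lemma hammingxx x : hamming w x x = 0.
Proof. by apply: big1 => j _; rewrite eqxx. Qed.

Lemma hammingC x y : hamming w x y = hamming w y x.
Proof. by apply: eq_bigr => j _; rewrite eq_sym. Qed.

Lemma hamming_triangle y x z : hamming w x z <= hamming w x y + hamming w y z.
Proof.
rewrite -big_split; apply: leq_sum => j _ /=.
case: (eqVneq (entry w x j) (entry w y j)) => [->|_] //.
exact: leq_trans (leq_b1 _) (leq_addr _ _).
Qed.

Definition source_matrix (s : nat -> nat) : 'M['I_(dom_size I)]_(m, n) :=
  \matrix_(x, j) M (insubd x (s x)) j.

Lemma source_row (s : nat -> nat) (x y : 'I_m) : s x = y -> row x (source_matrix s) = row y M.
Proof.
move=> E; apply/rowP => j; rewrite !mxE E; congr (M _ j); apply/val_inj.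
by rewrite val_insubd ltn_ord.
Qed.

Lemma sum_distance (M' : 'M_(m, n)) :
  distance M M' = \sum_(x < m) \sum_(j < n) (M x j != M' x j).
Proof.
rewrite pair_bigA /= /distance -sum1_card big_mkcond.
by apply: eq_bigr => q _; rewrite inE; case: (_ != _).
Qed.

Section Source.
Variable s : nat -> nat.
Hypothesis s_lt : forall x, x < m -> s x < m.
Let s' (x : 'I_m) := Ordinal (s_lt (ltn_ord x)).
Let M' := source_matrix s.

Let row_M' x : row x M' = row (s' x) M.
Proof. exact: source_row. Qed.

Lemma source_class (v : 'I_m) : sz m (hamming w) s v = #|[set y | row y M' == row v M]|.
Proof.
rewrite -sum1_card big_mkcond; apply: eq_bigr => y _.
by rewrite inE row_M' [_ == row v M]eq_sym -hamming_eq0 /=; case: (_ == _).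
Qed.

Lemma source_class_colour (v z : 'I_m) :
  cnt m (hamming w) (colour w) s v (colour w z)
  = #|[set y in [set y | row y M' == row v M] | tnth (color I) y == tnth (color I) z]|.
Proof.
rewrite -sum1_card [in RHS]big_mkcond; apply: eq_bigr => y _.
rewrite !inE row_M' [_ == row v M]eq_sym -hamming_eq0 !colourE (inj_eq val_inj) /=.
by case: (_ && _).
Qed.

Lemma ncolourE (z : 'I_m) :
  ncolour m (colour w) (colour w z) = color_count (color I) (tnth (color I) z).
Proof.
by rewrite color_countE; apply: eq_bigr => y _; rewrite !colourE (inj_eq val_inj).
Qed.

Lemma source_fair : fair (color I) M' <->
  [forall x : 'I_m, fair_at m (hamming w) (colour w) s (s x)].
Proof.
split=> [/(fairP _ _ nrows_gt0) H|/forallP H].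
  apply/forallP => x; apply/forallP => z; apply/eqP.
  rewrite (source_class (s' x)) (source_class_colour (s' x)) ncolourE -row_M'.
  exact: H.
apply/(fairP _ _ nrows_gt0) => x i.
have [i0|] := posnP (color_count (color I) i).
  rewrite i0 (_ : [set y in _ | _] = set0) ?cards0 //; apply/setP => y; rewrite !inE.
  apply/negbTE/negP => /andP[_ Ey]; move/eqP: i0.
  by rewrite color_countE sum_nat_eq0 => /forallP/(_ y); rewrite Ey.
rewrite color_countE lt0n sum_nat_eq0 => /forallPn[z]; rewrite eqb0 negbK => /eqP <-.
have /forallP/(_ z)/eqP := H x.
rewrite (source_class (s' x)) (source_class_colour (s' x)) ncolourE -row_M'.
by rewrite -color_countE; apply.
Qed.

Lemma source_distance : distance M M' = \sum_(x < m) hamming w x (s x).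
Proof.
rewrite sum_distance; apply: eq_bigr => x _; rewrite (hammingE x (s' x)).
apply: eq_bigr => j _; congr (_ != _).
by have /rowP/(_ j) := row_M' x; rewrite !mxE => ->.
Qed.

(** Every row of [M'] is a row of the input, hence equal to exactly one first row, whose new cluster
    is nonempty. *)
Lemma source_distinct_rows : distinct_rows M' =
  \sum_(v < m) (first_row m (hamming w) v && (0 < sz m (hamming w) s v)).
Proof.
pose A := [set v : 'I_m | first_row m (hamming w) v && (0 < sz m (hamming w) s v)].
have -> : \sum_(v < m) (first_row m (hamming w) v && (0 < sz m (hamming w) s v)) = #|A|.
  by rewrite -sum1_card [in RHS]big_mkcond; apply: eq_bigr => v _; rewrite inE; case: (_ && _).
have inj_A : {in A &, injective (fun v => row v M)}.
  move=> u v; rewrite !inE => /andP[/forallP Fu _] /andP[/forallP Fv _] /eqP.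
  rewrite -hamming_eq0 => E; have [lt|lt|/val_inj//] := ltngtP u v.
    by have := Fv u; rewrite lt hammingC E.
  by have := Fu v; rewrite lt E.
rewrite -(card_in_imset inj_A); congr #|pred_of_set _|; apply/setP => R.
apply/imsetP/imsetP => [[x _ ->]|[v]].
  have [u [Fu /eqP Eu _]] := first_rowP hammingxx hammingC hamming_triangle (s_lt (ltn_ord x)).
  have {}Eu : row (s' x) M = row u M by apply/eqP; rewrite -hamming_eq0.
  exists u; last by rewrite row_M' Eu.
  rewrite inE Fu source_class card_gt0; apply/set0Pn; exists x.
  by rewrite inE row_M' Eu.
rewrite inE => /andP[_]; rewrite source_class card_gt0 => /set0Pn[x].
by rewrite inE => /eqP E ->; exists x.
Qed.

Lemma valid_solution :
  valid m (budget I) (max_rows I) (hamming w) (colour w) s <-> fdmc_solution M'.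
Proof.
split=> [/and3P[fair_s cost_s rows_s]|[fair_s cost_s rows_s]].
  by split; [apply/source_fair | rewrite source_distance | rewrite source_distinct_rows].
apply/and3P; split; first exact/source_fair.
  by rewrite -source_distance.
by rewrite -source_distinct_rows.
Qed.

End Source.

Lemma solution_source M' : @fdmc_solution I M' ->
  exists s, (forall x, x < m -> s x < m) /\ source_matrix s = M'.
Proof.
case=> /(fairP _ _ nrows_gt0) fair_M' dist_M' _.
have ex_row x : exists y, row x M' == row y M.
  have dvd_x : fairlet_size I %| #|class M' x|.
    by rewrite /fairlet_size; apply: (fairlet_dvd nrows_gt0) => z; rewrite -fair_M' dvdn_mull.
  have gt_x : 0 < #|class M' x| by rewrite card_gt0; apply/set0Pn; exists x; rewrite inE.
  have lt_x : distance M M' < #|class M' x|.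
    exact: leq_ltn_trans dist_M' (leq_trans fairlet_gt (dvdn_leq gt_x dvd_x)).
  (* If row [x] of [M'] did not occur in [M], each row of its class would contain a modified entry,
     so the distance would be at least the size of the class. *)
  apply/existsP; apply: contraTT lt_x => /existsPn neq; rewrite -leqNgt sum_distance.
  rewrite -sum1_card big_mkcond; apply: leq_sum => y _; case: ifP => //.
  rewrite inE lt0n sum_nat_eq0 => /eqP Ey; apply/negP => /forallP H.
  have /eqP := neq y; apply; rewrite -Ey; apply/rowP => j; have := H j.
  by rewrite !mxE eqb0 negbK => /eqP.
pose s x := if insub x is Some x' then nat_of_ord (xchoose (ex_row x')) else 0.
have sE (x : 'I_m) : s x = xchoose (ex_row x) by rewrite /s valK.
exists s; split=> [x lt_x|]; first by rewrite (sE (Ordinal lt_x)).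
apply/row_matrixP => x; rewrite (source_row (sE x)).
by apply/esym/eqP/(xchooseP (ex_row x)).
Qed.

Lemma search_spec : (search w = 0 /\ forall a, a < guesses w -> ~~ good_guess w a)
  \/ (0 < search w /\ good_guess w (search w - 1)).
Proof.
suff spec b acc : loop (fun a acc => if good_guess w a then a.+1 else acc) b acc = acc /\
    (forall a, a < b -> ~~ good_guess w a)
  \/ 0 < loop (fun a acc => if good_guess w a then a.+1 else acc) b acc /\
     good_guess w (loop (fun a acc => if good_guess w a then a.+1 else acc) b acc - 1).
  exact: spec.
elim: b acc => [|b IH] acc /=; first by left.
case: (IH (if good_guess w b then b.+1 else acc)) => [[-> none]|]; last by right.
case: ifP => good_b; first by right; rewrite subn1.
left; split=> // a; rewrite ltnS leq_eqVlt => /predU1P[->|/none//].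
by rewrite good_b.
Qed.

Lemma guessed_source_lt a x : x < m -> guessed_source w a x < m.
Proof. exact: source_lt. Qed.

(** The base is at most [2 ^ (2 * k)], so the power is at most [2 ^ (6 * k * k)]; since
    [k * k <= 2 ^ (2 * k)], the factor [2 ^ 3] of the inner power absorbs the 6. *)
Lemma leq_guesses : (2 * budget I + 1) ^ (3 * budget I) <= guesses w.
Proof.
rewrite /guesses; have -> : w 4 = budget I by [].
set k := budget I.
have le_base : 2 * k + 1 <= 2 ^ (2 * k) by rewrite addn1; apply: ltn_expl.
have le_k : k * k <= 2 ^ (2 * k).
  by rewrite mul2n -addnn expnD leq_mul //; apply/ltnW/ltn_expl.
have [->|k_gt0] := posnP k; first by rewrite expn0 expn_gt0.
apply: leq_trans (_ : (2 ^ (2 * k)) ^ (3 * k) <= _).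
  by rewrite leq_exp2r // muln_gt0.
rewrite -expnM leq_exp2l // expnD; lia.
Qed.

Lemma completeness M' : @fdmc_solution I M' ->
  exists2 a, a < guesses w & good_guess w a.
Proof.
move=> sol; have [s [s_lt E]] := solution_source sol.
rewrite -E in sol; have /(valid_solution s_lt) valid_s := sol.
have dvd_t t : (forall z : 'I_m, m %| ncolour m (colour w) (colour w z) * t) ->
    fairlet_size I %| t.
  by move=> H; rewrite /fairlet_size; apply: (fairlet_dvd nrows_gt0) => z; rewrite -ncolourE.
have [d lt_d Hd] := exists_digits hammingxx hammingC hamming_triangle s_lt valid_s
  nrows_gt0 fairlet_gt dvd_t.
have base_gt0 : 0 < 2 * budget I + 1 by rewrite addn1.
have [a lt_a Ea] := exists_digit_of base_gt0 lt_d leq_guesses.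
by exists a => //; apply: Hd.
Qed.

Lemma output_correct :
  fdmc_answer I (mkseq (output_word w (search w)) (output_size w (search w))).
Proof.
have [[-> none]|[g_gt0 good]] := search_spec.
  left; split=> // -[M' /completeness[a lt_a good_a]].
  by have := none a lt_a; rewrite good_a.
right; have lt_s := guessed_source_lt (search w - 1).
exists (source_matrix (guessed_source w (search w - 1))); split.
  exact/(valid_solution (lt_s)).
have -> : output_size w (search w) = (m * n).+1.
  by rewrite /output_size -[search w == 0]leqn0 leqNgt g_gt0.
rewrite /mkseq /= {1}/output_word -[search w == 0]leqn0 leqNgt g_gt0 /=; congr (_ :: _).
apply: (@eq_from_nth _ 0); first by rewrite size_map size_iota size_entries.
move=> q; rewrite size_map size_iota => lt_q; rewrite (nth_map 0) ?size_iota // nth_iota //.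
have n_gt0 : 0 < n by move: lt_q; case: n; rewrite ?muln0.
have lt_x : q %/ n < m by rewrite ltn_divLR.
rewrite [in RHS](divn_eq q n).
rewrite (nth_entries _ (Ordinal lt_x) (Ordinal (ltn_pmod q n_gt0))) mxE.
have quotE : quotient m n q = q %/ n by rewrite quotientE // ltnW.
rewrite /output_word -[search w == 0]leqn0 leqNgt g_gt0 /= add1n !subn1 /= quotE.
rewrite -subn1 -entryE val_insubd (lt_s _ lt_x).
by rewrite {2}(divn_eq q n) addKn.
Qed.

End Instance.

(** * Running time *)

(** Register 0 initially contains 1, the input length. It is left untouched and serves as the length
    of the output. *)
Lemma computable_expr e : computable (fun x => eval (nth 0 [:: x]) e [::]).
Proof.
pose P := compile e 0 [::] 1 ++ [:: IConst 2 0; IStore 2 1].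
exists P => x; have := code_at_self [::] P => /code_at_cat[Ce].
rewrite size_compile => -[Pc [Ps _]].
have [R reach_e [R_1 R_lt]] :=
  @compile_correct P (nth 0 [:: x]) _ _ [::] 1 (regs (init_state [:: x])) isT Ce.
have [|t _ Et] := reach_trans (s3 := State (csize e).+2 (upd R 2 0)
  (upd (nth 0 [:: x]) 0 (R 1))) (n2 := 2) reach_e.
  apply: (reach_instr Pc) => /=; apply: (reach_instr Ps) => /=.
  by rewrite upd_same upd_other //; apply: reach0.
exists t; rewrite /outputs_in /halted /output Et size_cat size_compile addn2 leqnn.
by rewrite /= (_ : upd R 2 0 0 = 1) /mkseq /= ?R_1 // upd_other // R_lt.
Qed.

Definition pow2_expr (e : expr) : expr := Loop e (Cst 1) (Plus (Var 1) (Var 1)).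

Lemma eval_pow2 w e env : eval w (pow2_expr e) env = 2 ^ eval w e env.
Proof. by rewrite /= loop_double mul1n. Qed.

(** Bounds the [D]-th power of the number of guesses, by [D <= 2 ^ D]. *)
Definition time_factor D k := 2 ^ 2 ^ (2 * k + 3 + D).

Lemma computable_time_factor D : computable (time_factor D).
Proof.
have [P HP] := computable_expr (pow2_expr (pow2_expr
  (Plus (Plus (Read (Cst 0)) (Read (Cst 0))) (Cst (3 + D))))).
exists P => x; have [t Ht] := HP x; exists t; move: Ht.
by rewrite !eval_pow2 /= addnn -mul2n addnA.
Qed.

Lemma size_leq_bitsize s : size s <= bitsize s.
Proof. by rewrite -sum1_size; apply: leq_sum. Qed.

Theorem theorem2 :
  fixed_parameter_tractable
    (@restrict FDMC (fun I : fdmc_instance => budget I < fairlet_size I)).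
Proof.
pose X := {I : fdmc_instance | budget I < fairlet_size I}.
pose inp (x : X) := fdmc_encode (sval x).
pose N (x : X) := guesses (nth 0 (inp x)) * bitsize (inp x).
have guesses_gt1 x : 1 < guesses (nth 0 (inp x)).
  by rewrite -{1}(expn0 2) ltn_exp2l // expn_gt0.
have bits_gt0 x : 0 < bitsize (inp x) by apply: leq_trans (size_leq_bitsize _).
have bits_leN x : bitsize (inp x) <= N x by rewrite leq_pmull // ltnW.
have guesses_leN x : guesses (nth 0 (inp x)) <= N x by rewrite leq_pmulr.
have N_gt1 x : 1 < N x by apply: leq_trans (guesses_leN x).
have size_inp x : size (inp x) = 6 + nth 0 (inp x) 0 * nth 0 (inp x) 1 + nth 0 (inp x) 0.
  exact: size_encode.
have size_leN x : size (inp x) <= N x.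
  exact: leq_trans (size_leq_bitsize _) (bits_leN x).
have bounded_leN f : (forall x, f (nth 0 (inp x)) <= N x) -> bounded inp N (fun w _ => f w).
  by move=> H; exists 1 => x env; rewrite expn1.
have bounded0 : bounded inp N (fun w _ => w 0).
  apply: (bounded_leN (fun w => w 0)) => x; apply: leq_trans (size_leN x).
  by rewrite size_inp leq_addl.
have bounded1 : bounded inp N (fun w _ => w 1).
  apply: (bounded_leN (fun w => w 1)) => x; apply: leq_trans (size_leN x).
  (* The input length bounds the number of columns only because there is at least one row. *)
  by have := nrows_gt0 (svalP x); rewrite size_inp -[nrows _]/(nth 0 (inp x) 0); nia.
have bounded4 : bounded inp N (fun w _ => w 4).
  apply: (bounded_leN (fun w => w 4)) => x; apply: leq_trans (guesses_leN x).
  apply: leq_trans (ltnW (ltn_expl _ (ltnSn 1))).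
  by apply: leq_trans (ltnW (ltn_expl _ (ltnSn 1))); rewrite /inp; lia.
have bounded_guesses := bounded_leN _ guesses_leN.
have [e1 [D1 H1]] := ptime_search N_gt1 size_inp bounded0 bounded1 bounded4 bounded_guesses.
have [e2 [D2 H2]] := ptime_output_size N_gt1 size_inp bounded0 (ptime_var inp N_gt1 0).
have [e3 [D3 H3]] := ptime_output_word N_gt1 size_inp bounded0 bounded1 bounded4
  bounded_guesses (ptime_var inp N_gt1 2) (ptime_var inp N_gt1 0).
have [D HD] : exists D, forall x,
    N x ^ D1 + N x ^ D2 + N x ^ 1 * (N x ^ D3 + 40) + 10 <= N x ^ D.
  eexists => x; apply: (leq_Nadd N_gt1 _ (leq_Ncst N_gt1 x 10)).
  apply: (leq_Nadd N_gt1 (leq_Nadd N_gt1 (leqnn _) (leqnn _))).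
  exact: leq_Nmul (leqnn _) (leq_Nadd N_gt1 (leqnn _) (leq_Ncst N_gt1 x 40)).
exists (compile_main e1 e2 e3), (time_factor D), D; split=> [|x].
  exact: computable_time_factor.
set g := search (nth 0 (inp x)); set l := output_size (nth 0 (inp x)) g.
have E1 env := H1 x (nth 0 (inp x)) env (fun _ _ => erefl).
have E2 env := H2 x (nth 0 (inp x)) env (fun _ _ => erefl).
have le_l : l <= size (inp x).
  by rewrite /l /output_size size_inp; case: ifP => _ //; lia.
have [||||t le_t out_t] := @compile_main_correct e1 e2 e3 (inp x) g l
    (output_word (nth 0 (inp x)) g) (N x ^ D3).
- by case: (E1 [:: size (inp x)]).
- by case: (E2 [:: g; size (inp x)]).
- exact: le_l.
- by move=> w i _ Hw; apply: H3.
exists t, (mkseq (output_word (nth 0 (inp x)) g) l); split=> //; last first.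
  exact: output_correct (svalP x).
apply: leq_trans le_t _.
apply: (@leq_trans (N x ^ D)).
  apply: leq_trans (HD x); rewrite leq_add2r leq_add // ?leq_add //.
  - by case: (E1 [:: size (inp x)]).
  - by case: (E2 [:: g; size (inp x)]).
  by rewrite leq_mul2r expn1 (leq_trans le_l) ?orbT.
rewrite expnMn leq_mul2r; apply/orP; right.
rewrite /time_factor /guesses -expnM leq_exp2l // [X in _ <= X]expnD leq_mul2l.
by rewrite ltnW ?orbT // ltn_expl.
Qed.
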